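(* Let $F$ be a field of characteristic $p\ge0$, let $q\in\Lambda(n)$ with $(q,p)=1$ and let $\lambda=\lambda(q)$. Then $\{\omega_q Q_T: T\in\Gamma(\lambda)\}$ is an $F$-basis of $\mathrm{Lie}_F(q)=\omega_qFS_n$. In particular $\dim_F\mathrm{Lie}_F(q)=\frac{n!}{q?}$, the number of permutations of $S_n$ of cycle type $\lambda$.
   Context: Permutations act on the right and are composed left to right; a permutation $\sigma\in S_n$ is identified with the word $(1)\sigma(2)\sigma\cdots(n)\sigma$, and a word whose letters are $1,\dots,n$ each once is identified with a permutation. Compositions $q=(q_1,\dots,q_k)$ of $n$; $q^+_j=q_1+\dots+q_j$; $m_i(q)$ = number of parts equal to $i$; $(q,p)=1$ means $p\nmid q_i$ for all $i$ (vacuous if $p=0$); $\lambda(q)$ is the partition obtained by rearranging $q$; $q?=\prod_i i^{m_i(q)}m_i(q)!$. $\Xi^q$ = sum of all $\sigma\in S_n$ whose descents (positions $i$ with $(i)\sigma>(i+1)\sigma$) lie in $\{q^+_1,\dots,q^+_k\}$. $\omega_m=(1-c_m)(1-c_{m-1})\cdots(1-c_2)\in FS_m$, $c_i=(i,i-1,\dots,1)$; $\sigma^{+r}$ maps $i+r\mapsto(i)\sigma+r$ for $i\le m$ and fixes the rest; $\omega^q=\omega_{q_1}^{+q^+_0}\cdots\omega_{q_k}^{+q^+_{k-1}}$, $\omega_q=\omega^q\Xi^q$. For a word $w=w_1\cdots w_m$ of distinct positive integers, $S_m$ acts by $\tau\cdot w=w_{(1)\tau}\cdots w_{(m)\tau}$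 (extended linearly), and $Q_w=\omega_m\cdot w$. For a partition $\lambda$ of $n$, $\Gamma(\lambda)$ is the set of tuples $T=(T_{n,1},\dots,T_{n,m_n(\lambda)},\dots,T_{1,1},\dots,T_{1,m_1(\lambda)})$ where each $T_{i,j}$ is a sequence of length $i$ of positive integers, all entries of all $T_{i,j}$ together are exactly $1,\dots,n$ each once, the first entry of each $T_{i,j}$ is its minimum, and $\min T_{i,1}<\min T_{i,2}<\dots<\min T_{i,m_i(\lambda)}$ for each $i$. Then $Q_T=Q_{T_{n,1}}\cdots Q_{T_{1,m_1(\lambda)}}$ (product = concatenation of words, extended bilinearly), regarded as an element of $FS_n$, and $\omega_qQ_T$ is a product in $FS_n$. *)

(* Defs.v *)
From mathcomp Require Import all_boot all_order all_algebra all_fingroup.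
Set Implicit Arguments. Unset Strict Implicit. Unset Printing Implicit Defensive.
Import GRing.Theory.
Local Open Scope ring_scope.

(* Conventions: the letters 1..n are represented by 'I_n = {0,..,n-1}
   (letter k+1 <-> ordinal k).  MathComp permutations compose left to right:
   (s * t) x = t (s x)  (lemma permM), matching the paper. *)

Section Defs.
Variable F : fieldType.

Definition galg (n : nat) := {ffun 'S_n -> F}.

Definition gdelta n (s : 'S_n) : galg n := [ffun t => (t == s)%:R].
Definition gone n : galg n := gdelta 1.
Definition gscale n (c : F) (a : galg n) : galg n := [ffun s => c * a s].
Definition gmul n (a b : galg n) : galg n :=
  [ffun s => \sum_(t : 'S_n) a t * b (t^-1 * s)%g].

Definition appn m (s : 'S_m) (j : nat) : nat :=
  if insub j is Some k then val (s k) else j.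
Definition ofun n (f : nat -> nat) : 'I_n -> 'I_n := fun j => insubd j (f j).
Definition permn n (f : nat -> nat) : 'S_n :=
  match injectiveb (@ofun n f) as b return injectiveb (@ofun n f) = b -> 'S_n with
  | true => fun H => perm (injectiveP _ H)
  | false => fun _ => 1%g
  end erefl.

(* c_i = (i, i-1, ..., 1) in S_m: i -> i-1 -> ... -> 1 -> i (1-indexed) *)
Definition cyc m (i : nat) : 'S_m :=
  permn m (fun j => if j == 0%N then i.-1 else if (j < i)%N then j.-1 else j).

Definition omega m : galg m :=
  foldr (@gmul m) (gone m)
    [seq gone m - gdelta (cyc m i) | i <- rev (iota 2 m.-1)].

Definition shiftp n m (r : nat) (s : 'S_m) : 'S_n :=
  permn n (fun j => if (r <= j)%N && (j < r + m)%N then (r + appn s (j - r))%N else j).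
Definition shifta n m r (a : galg m) : galg n :=
  \sum_(s : 'S_m) gscale (a s) (gdelta (shiftp n r s)).

Definition is_composition (n : nat) (q : seq nat) : bool :=
  all (fun x => 0 < x)%N q && (sumn q == n).
Definition coprime_char (q : seq nat) : Prop :=
  forall p, p \in [pchar F] -> all (fun x => ~~ (p %| x)%N) q.
Definition qplus (q : seq nat) (j : nat) : nat := sumn (take j q).

Definition omega_up n (q : seq nat) : galg n :=
  foldr (@gmul n) (gone n)
    [seq shifta n (qplus q j) (omega (nth 0%N q j)) | j <- iota 0 (size q)].

(* descent positions i (1 <= i <= n-1) with (i)s > (i+1)s, 1-indexed *)
Definition descents n (s : 'S_n) : seq nat :=
  [seq i <- iota 1 n.-1 | (appn s i < appn s i.-1)%N].
Definition Xi n (q : seq nat) : galg n :=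
  \sum_(s : 'S_n | all (fun i => i \in [seq qplus q j | j <- iota 1 (size q)])
                       (descents s)) gdelta s.

Definition omega_q n q : galg n := gmul (omega_up n q) (Xi n q).

Definition inLie n q (y : galg n) : Prop := exists x : galg n, y = gmul (omega_q n q) x.

Definition lincomb := seq (F * seq nat).
Definition wact m (t : 'S_m) (w : seq nat) : seq nat :=
  [seq nth 0%N w (t i) | i <- enum 'I_m].
Definition Qw (w : seq nat) : lincomb :=
  [seq (omega (size w) t, wact t w) | t <- enum 'S_(size w)].
Definition lc_mul (a b : lincomb) : lincomb :=
  [seq (x.1 * y.1, x.2 ++ y.2) | x <- a, y <- b].
Definition QT (T : seq (seq nat)) : lincomb := foldr lc_mul [:: (1, [::])] (map Qw T).

Definition word n (s : 'S_n) : seq nat := [seq (val (s i)).+1 | i <- enum 'I_n].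
Definition perm_of_word n (w : seq nat) : galg n :=
  if [pick s : 'S_n | word s == w] is Some s then gdelta s else 0.
Definition to_alg n (a : lincomb) : galg n :=
  \sum_(x <- a) gscale x.1 (perm_of_word n x.2).

End Defs.

Definition lam (q : seq nat) : seq nat := sort geq q.

Definition inGamma (n : nat) (l : seq nat) (T : seq (seq nat)) : Prop :=
  [/\ map size T = l,
      perm_eq (flatten T) (iota 1 n),
      all (fun t => all (fun x => head 0 t <= x) t) T &
      forall k k', k < k' < size T -> size (nth [::] T k) = size (nth [::] T k') ->
        head 0 (nth [::] T k) < head 0 (nth [::] T k')]%N.

Definition qmark (q : seq nat) : nat :=
  \prod_(i <- undup q) (i ^ count_mem i q * (count_mem i q)`!)%N.

Definition cycle_type n (s : 'S_n) : seq nat :=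
  sort geq [seq #|X| | X : {set 'I_n} <- enum (porbits s)].

(* Main.v *)
From HB Require Import structures.
From mathcomp Require Import all_boot all_order all_algebra all_fingroup.
From mathcomp Require Import finmap zify.
From mathcomp.multinomials Require Import monalg.
Require Import Defs.
Set Implicit Arguments. Unset Strict Implicit. Unset Printing Implicit Defensive.
Import GRing.Theory.
Local Open Scope ring_scope.

(** Identify a permutation with its word, so that FS_n becomes the multilinear
    part of the free associative algebra and left multiplication permutes
    positions.  Left multiplication by omega_m is the left-normed bracketing
    w |-> Q_w, and omega_q sends w to the sum, over all ways of cutting w into
    subwords u_1, ..., u_k of lengths q_1, ..., q_k, of Q_{u_1} ... Q_{u_k}: it
    is a convolution of bracketings for the coproduct making letters primitive.

    Since Lie elements are primitive and omega_m Q_u = m Q_u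
    (Dynkin-Specht-Wever), applying omega_q to a product of k brackets of the
    right degrees gives (q_1 ... q_k) times the sum of all their rearrangements
    with degree sequence q.

    - Independence: if u starts with its minimum, u is the only word of Q_u
      that starts with that letter; hence the coefficient of a concatenation of
      such words in the above sum is q_1 ... q_k for exactly one T and 0 for
      the others.
    - Spanning: each Q_{u_i} is a combination of brackets of words starting with
      their minimum; after this rewriting of omega_q w, the coefficient of
      Q_{b_1} ... Q_{b_k} is a product over the blocks b_i, hence symmetric in
      them, so the blocks can be collected into rearrangement classes, which
      are indexed by Gamma(lambda).
    - Counting: sorting blocks gives n! = (q_1 ... q_k) (prod_i m_i!) |Gamma|, and
      reading each cycle from its minimum identifies Gamma(lambda) with the
      permutations of cycle type lambda. *)

(** * The algebra of words *)

Lemma cat_eq_nil (T : Type) (u v : seq T) : u ++ v = [::] -> u = [::] /\ v = [::].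
Proof. by case: u => [|x u] //=; case: v. Qed.

(** With concatenation as product of monomials, [{malg F[seq nat]}] is the free associative algebra
    on the letters. *)
HB.instance Definition _ (T : choiceType) :=
  Choice_isMonomialDef.Build (seq T) (@catA T) (@cat0s T) (@cats0 T)
    (@cat_eq_nil T).

Section Bracket.
Variable A : nzRingType.
Implicit Types a b c : A.

Definition brk a b := a * b - b * a.

Lemma brkDl a b c : brk (a + b) c = brk a c + brk b c.
Proof. by rewrite /brk mulrDl mulrDr addrACA opprD. Qed.

Lemma brkC a b : brk a b = - brk b a.
Proof. by rewrite /brk opprB. Qed.

Lemma brk_jacobi a b c : brk (brk a b) c - brk (brk a c) b = brk a (brk b c).
Proof.
rewrite /brk !(mulrBl, mulrBr) !mulrA !opprB !addrA.
(* Of the eight monomials, the two [b a c] and the two [c a b] cancel; the other four are put in the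
   order of the right-hand side. *)
rewrite [LHS](ACl (1*8*3*6*(5*2)*(7*4))) /=.
by rewrite !subrr !addr0.
Qed.

End Bracket.

Notation walg F := {malg F[seq nat]}.

Section WordAlgebra.
Variable F : fieldType.
Implicit Types (a b : walg F) (u v w : seq nat).

Definition wd w : walg F := << w >>.

Lemma wd_nil : wd [::] = 1. Proof. by []. Qed.

Lemma wdM u v : wd u * wd v = wd (u ++ v).
Proof. by rewrite /wd malgM_def fgmulUU mulr1. Qed.

Lemma coef_wd u w : (wd u)@_w = (u == w)%:R.
Proof. exact: mcoeffU1. Qed.

Lemma walgE a : a = \sum_(w <- msupp a) a@_w *: wd w.
Proof.
rewrite {1}[a]monalgE; apply: eq_bigr => w _.
by apply/malgP => k; rewrite mcoeffZ !mcoeffU mulr_natr.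
Qed.

Lemma walg_scalerAr (c : F) a b : c *: (a * b) = a * (c *: b).
Proof.
rewrite (malgMEw (fsubset_refl _) (msuppZ_le c b)) malgME scaler_sumr.
apply: eq_bigr => u _; rewrite scaler_sumr; apply: eq_bigr => v _.
by apply/malgP => k; rewrite !mcoeffZ !mcoeffU !mulrnAr mulrCA.
Qed.

Section Extension.
Variable V : lmodType F.
Implicit Types f g : seq nat -> V.

(** The linear map that takes the values [f] on the basis of words. *)
Definition ext f a : V := \sum_(w <- msupp a) a@_w *: f w.

Lemma ext_wide f a (d : {fset seq nat}) :
  (msupp a `<=` d)%fset -> ext f a = \sum_(w <- d) a@_w *: f w.
Proof.
move=> sd; rewrite /ext (big_fset_incl _ sd) // => w _ /mcoeff_outdom ->.
exact: scale0r.
Qed.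

Lemma ext_is_linear f : linear (ext f).
Proof.
move=> c a b; pose d := (msupp a `|` msupp b)%fset.
have sa : (msupp a `<=` d)%fset by exact: fsubsetUl.
have sb : (msupp b `<=` d)%fset by exact: fsubsetUr.
have sab : (msupp (c *: a + b) `<=` d)%fset.
  apply: fsubset_trans (msuppD_le _ _) _.
  by rewrite fsubUset sb (fsubset_trans (msuppZ_le _ _)).
rewrite (ext_wide _ sa) (ext_wide _ sb) (ext_wide _ sab) scaler_sumr -big_split.
by apply: eq_bigr => w _ /=; rewrite mcoeffD mcoeffZ scalerDl scalerA.
Qed.
HB.instance Definition _ f := GRing.isLinear.Build F (walg F) V *:%R (ext f)
  (ext_is_linear f).

Lemma ext_wd f w : ext f (wd w) = f w.
Proof.
by rewrite (ext_wide f (d := [fset w]%fset)) ?msuppU_le // big_seq_fset1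
           coef_wd eqxx scale1r.
Qed.

Lemma ext1 f : ext f 1 = f [::]. Proof. exact: ext_wd. Qed.

Lemma eq_ext f g a : {in msupp a, f =1 g} -> ext f a = ext g a.
Proof.
by move=> fg; rewrite /ext big_seq [RHS]big_seq; apply: eq_bigr => w /fg ->.
Qed.

Lemma extDf f g a : ext (fun w => f w + g w) a = ext f a + ext g a.
Proof. by rewrite /ext -big_split; apply: eq_bigr => w _; rewrite scalerDr. Qed.

Lemma ext_sumf (J : Type) (r : seq J) (P : pred J) (f : J -> seq nat -> V) a :
  ext (fun w => \sum_(j <- r | P j) f j w) a = \sum_(j <- r | P j) ext (f j) a.
Proof.
rewrite /ext exchange_big; apply: eq_bigr => w _.
by rewrite scaler_sumr.
Qed.

Lemma extM f a b : ext f (a * b) = ext (fun u => ext (fun v => f (u ++ v)) b) a.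
Proof.
rewrite {1}(walgE a) mulr_suml linear_sum; apply: eq_bigr => u _.
rewrite -scalerAl linearZ /=; congr (_ *: _).
rewrite {1}(walgE b) mulr_sumr linear_sum; apply: eq_bigr => v _.
by rewrite -walg_scalerAr linearZ /= wdM ext_wd.
Qed.

Lemma exchange_ext (B : seq nat -> seq nat -> V) a b :
  ext (fun u => ext (B u) b) a = ext (fun v => ext (B^~ v) a) b.
Proof.
rewrite /ext; under eq_bigr do rewrite scaler_sumr.
rewrite exchange_big; apply: eq_bigr => v _; rewrite scaler_sumr.
by apply: eq_bigr => u _; rewrite !scalerA mulrC.
Qed.
End Extension.

Lemma ext_lin (V W : lmodType F) (h : {linear V -> W}) (f : seq nat -> V) a :
  ext (fun w => h (f w)) a = h (ext f a).
Proof. by rewrite /ext linear_sum; apply: eq_bigr => w _; rewrite linearZ. Qed.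

Lemma ext_id a : ext wd a = a. Proof. by rewrite [RHS]walgE. Qed.

Lemma ext_mull (f : seq nat -> walg F) b a : ext (fun w => b * f w) a = b * ext f a.
Proof.
by rewrite /ext mulr_sumr; apply: eq_bigr => w _; rewrite walg_scalerAr.
Qed.

Lemma ext_mulr (f : seq nat -> walg F) b a : ext (fun w => f w * b) a = ext f a * b.
Proof.
by rewrite /ext mulr_suml; apply: eq_bigr => w _; rewrite scalerAl.
Qed.

(** The right adjoint action of the word [u], letter by letter from the left. *)
Definition adw u a := foldl (fun b x => brk b (wd [:: x])) a u.

(* The left-normed bracket Q_w; the value 1 at the empty word agrees with Qw. *)
Definition lie w := if w is x :: u then adw u (wd [:: x]) else 1.

Lemma brkZl (k : F) a c : brk (k *: a) c = k *: brk a c.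
Proof. by rewrite /brk -scalerAl -walg_scalerAr -scalerBr. Qed.

Lemma brk_linear (c : walg F) : linear (fun a => brk a c).
Proof. by move=> k a b; rewrite brkDl brkZl. Qed.

Lemma adw_cat u v a : adw (u ++ v) a = adw v (adw u a).
Proof. exact: foldl_cat. Qed.

Lemma adw_linear u : linear (adw u).
Proof.
by elim: u => [|x u IH] k a b //=; rewrite brk_linear IH.
Qed.
HB.instance Definition _ u := GRing.isLinear.Build F (walg F) (walg F) *:%R (adw u)
  (adw_linear u).

Lemma lie_rcons w x : w != [::] -> lie (rcons w x) = brk (lie w) (wd [:: x]).
Proof. by case: w => // y w _; rewrite rcons_cons /= /adw foldl_rcons. Qed.

Lemma lie_cat w u : w != [::] -> lie (w ++ u) = adw u (lie w).
Proof. by case: w => // y w _; rewrite /= adw_cat. Qed.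

End WordAlgebra.

(** * Unshuffles and left-normed brackets *)

Section Splits.
Variable T : Type.

(** All unshuffles: each letter goes to one of two complementary subwords, both of which keep the
    original order. *)
Fixpoint splits (s : seq T) : seq (seq T * seq T) :=
  if s is x :: s' then
    [seq (x :: p.1, p.2) | p <- splits s'] ++ [seq (p.1, x :: p.2) | p <- splits s']
  else [:: ([::], [::])].

Variable V : zmodType.
Implicit Types B : seq T -> seq T -> V.

(* [deshuf B s] is B applied to the coproduct of s for which letters are primitive. *)
Definition deshuf B s : V := \sum_(p <- splits s) B p.1 p.2.

Lemma deshuf_nil B : deshuf B [::] = B [::] [::].
Proof. by rewrite /deshuf big_seq1. Qed.

Lemma deshuf_cons B x s :
  deshuf B (x :: s) =
  deshuf (fun u v => B (x :: u) v) s + deshuf (fun u v => B u (x :: v)) s.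
Proof. by rewrite /deshuf /= big_cat !big_map. Qed.

Lemma eq_deshuf B B' s : (forall u v, B u v = B' u v) -> deshuf B s = deshuf B' s.
Proof. by move=> e; apply: eq_bigr => p _; rewrite e. Qed.

(** The coproduct is an algebra map: the letters of [s] and those of [t] are distributed
    independently. *)
Lemma deshuf_cat B s t :
  deshuf B (s ++ t) =
  deshuf (fun u v => deshuf (fun u' v' => B (u ++ u') (v ++ v')) t) s.
Proof.
elim: s B => [|x s IH] B /=; first by rewrite deshuf_nil.
by rewrite !deshuf_cons !IH.
Qed.

Lemma deshuf_nilP B s : (forall x u v, B (x :: u) v = 0) -> deshuf B s = B [::] s.
Proof.
elim: s B => [|x s IH] B B0; first exact: deshuf_nil.
rewrite deshuf_cons IH; last by move=> *; exact: B0.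
by rewrite IH ?B0 ?add0r // => *; exact: B0.
Qed.

End Splits.

Lemma mem_splits_size (T : eqType) (s : seq T) p :
  p \in splits s -> (size p.1 + size p.2 = size s)%N.
Proof.
elim: s p => [|x s IH] p /=; first by rewrite inE => /eqP ->.
rewrite mem_cat => /orP[] /mapP[r /IH rs -> /=]; rewrite ?addSn ?addnS rs //.
Qed.

(** The surviving splits extract a single letter [x]; since the letters are distinct, [rem x s] is
    what is left. *)
Lemma deshuf_oneP (T : eqType) (V : zmodType) (B : seq T -> seq T -> V) s :
  uniq s ->
  (forall u v, size u != 1%N -> B u v = 0) ->
  deshuf B s = \sum_(x <- s) B [:: x] (rem x s).
Proof.
elim: s B => [|x s IH] B /=; first by rewrite deshuf_nil big_nil => _ ->.
case/andP=> xs us B0; rewrite deshuf_cons big_cons eqxx; congr (_ + _).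
  by rewrite deshuf_nilP // => y u v; exact: B0.
rewrite IH //; last by move=> *; exact: B0.
apply: eq_big_seq => y ys; congr (B _ _).
by case: eqP ys xs => // -> ->.
Qed.

Section Lie.
Variable F : fieldType.
Implicit Types (a b : walg F) (u v w : seq nat).
Local Notation wd := (wd F).
Local Notation lie := (lie F).

Lemma coef_sum a w : a@_w = \sum_(u <- msupp a) a@_u * (u == w)%:R.
Proof.
rewrite {1}(walgE a) raddf_sum; apply: eq_bigr => u _ /=.
by rewrite mcoeffZ coef_wd.
Qed.

Lemma coefM a b w :
  (a * b)@_w = \sum_(u <- msupp a) \sum_(v <- msupp b) a@_u * b@_v * (u ++ v == w)%:R.
Proof.
by rewrite mcoeffMl; apply: eq_bigr => u _; apply: eq_bigr => v _; rewrite mulr_natr.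
Qed.

(** All words of [a] have the length of [u], so [u ++ v] can be cut in one place only. *)
Lemma coefM_split a b u v : {in msupp a, forall w, size w = size u} ->
  (a * b)@_(u ++ v) = a@_u * b@_v.
Proof.
move=> sa; rewrite coefM (coef_sum a u) (coef_sum b v) mulr_suml.
rewrite big_seq [RHS]big_seq; apply: eq_bigr => w /sa sw.
rewrite mulr_sumr; apply: eq_bigr => w' _.
by rewrite eqseq_cat // -mulnb natrM mulrACA.
Qed.

Lemma coefMr a x w y : (a * wd [:: x])@_(rcons w y) = a@_w * (x == y)%:R.
Proof.
rewrite coefM (coef_sum a w) mulr_suml; apply: eq_bigr => u _.
by rewrite msuppU1 big_seq_fset1 coef_wd eqxx mulr1 cats1 eqseq_rcons -mulnb natrM mulrA.
Qed.

Lemma coefMl a x w y : (wd [:: x] * a)@_(y :: w) = (x == y)%:R * a@_w.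
Proof.
rewrite coefM (coef_sum a w) mulr_sumr msuppU1 big_seq_fset1; apply: eq_bigr => u _.
by rewrite coef_wd eqxx mul1r /= eqseq_cons -mulnb natrM mulrCA.
Qed.

(** Induction along left-normed brackets. The empty word is left out because its value 1 is not a
    Lie element. *)
Lemma lie_ind (P : seq nat -> Prop) :
  (forall x, P [:: x]) -> (forall u x, u != [::] -> P u -> P (rcons u x)) ->
  forall u, u != [::] -> P u.
Proof.
move=> P1 PS; elim/last_ind => // u x IH _.
by case: (eqVneq u [::]) => [-> |un]; [exact: P1 | apply: PS => //; exact: IH].
Qed.

Lemma msupp_wd w : msupp (wd w) = [fset w]%fset.
Proof. exact: msuppU1. Qed.

Lemma msupp_lie u w : w \in msupp (lie u) -> perm_eq w u.
Proof.
case: (eqVneq u [::]) => [-> | un]; first by rewrite msupp_wd inE => /eqP ->.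
move: u un w; apply: lie_ind => [x|u x un IH] w.
  by rewrite msupp_wd inE => /eqP ->.
rewrite lie_rcons // => /(fsubsetP (msuppB_le _ _)); rewrite inE => /orP[].
all: case/msuppM_le => w1 [w2 [H1 H2 ->]].
  move: H2; rewrite msupp_wd inE => /eqP ->.
  by rewrite -cats1 perm_cat2r IH.
move: H1; rewrite msupp_wd inE => /eqP ->.
by rewrite perm_sym perm_rcons perm_sym /= perm_cons IH.
Qed.

Lemma msupp_ext (f : seq nat -> walg F) a v :
  v \in msupp (ext f a) -> exists2 w, w \in msupp a & v \in msupp (f w).
Proof.
move=> H; have [/hasP[w]|/hasPn N] := boolP (has (fun w => v \in msupp (f w)) (msupp a)).
  by exists w.
move: H; rewrite -mcoeff_neq0 /ext raddf_sum big_seq big1 ?eqxx // => w /N /=.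
by rewrite mcoeffZ => /mcoeff_outdom ->; rewrite mulr0.
Qed.

(** By the Jacobi identity the adjoint action is a representation of the Lie algebra, so acting by
    the combination of words [lie u] is bracketing with [lie u]. *)
Lemma ext_adw_lie u a : u != [::] -> ext (fun v => adw v a) (lie u) = brk a (lie u).
Proof.
move=> un; move: u un a; apply: lie_ind => [x|u x un IH] a.
  by rewrite ext_wd.
rewrite lie_rcons // {1}/brk linearB /= !extM ext_wd.
under eq_ext => v _ do rewrite ext_wd adw_cat.
rewrite (_ : ext _ _ = brk (ext (fun v => adw v a) (lie u)) (wd [:: x])).
  by rewrite !IH -brk_jacobi.
by rewrite [RHS]/brk -ext_mulr -ext_mull /ext -sumrB; apply: eq_bigr => v _;
   rewrite -scalerBr.
Qed.

(* Dynkin-Specht-Wever: adw v is multiplicative in v and ext_adw_lie says that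
   it is an inner derivation on Lie elements, so applying the bracketing to
   [lie u, x] gives (size u) [lie u, x] - [x, lie u]. *)
Lemma ext_lie_lie u : u != [::] -> ext lie (lie u) = (size u)%:R *: lie u.
Proof.
move: u; apply: lie_ind => [x|u x un IH]; first by rewrite ext_wd scale1r.
rewrite lie_rcons // {1}/brk linearB /= !extM ext_wd.
rewrite ext_adw_lie // (brkC (wd [:: x])) opprK size_rcons -addn1 natrD scalerDl scale1r.
congr (_ + _).
have -> : ext (fun w => ext (fun v => lie (w ++ v)) (wd [:: x])) (lie u)
        = ext (fun w => lie w * wd [:: x] - wd [:: x] * lie w) (lie u).
  apply: eq_ext => w /msupp_lie wu; rewrite ext_wd cats1 lie_rcons //.
  by case: w wu => //; rewrite perm_sym => /perm_nilP; move/eqP: un.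
rewrite (_ : ext _ _ = brk (ext lie (lie u)) (wd [:: x])).
  by rewrite IH brkZl.
by rewrite [RHS]/brk -ext_mulr -ext_mull /ext -sumrB; apply: eq_bigr => v _;
   rewrite -scalerBr.
Qed.

(** Bracketing with a letter [x] other than [m] gives one term that begins with [x] and one that
    appends [x]; only the latter can begin with [m]. *)
Lemma coef_lie_head m u v : m \notin u -> (lie (m :: u))@_(m :: v) = (u == v)%:R.
Proof.
elim/last_ind: u v => [|u x IH] v; first by rewrite coef_wd eqseq_cons eqxx.
rewrite mem_rcons inE negb_or => /andP[mx mu].
rewrite -rcons_cons lie_rcons // /brk mcoeffB coefMl eq_sym (negPf mx) mul0r subr0.
case/lastP: v => [|v y].
  rewrite -[[:: m]]/(rcons [::] m) coefMr eq_sym (negPf mx) mulr0.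
  by case: u {IH mu}.
rewrite -rcons_cons coefMr IH // eqseq_rcons.
by case: (u == v); case: (x == y); rewrite ?mulr1 ?mul1r ?mulr0.
Qed.

(* [lie w] rewritten with first letter m: if w = w1 m w2 then
   [lie w1, m] = - [m, lie w1] and ext_adw_lie expands the latter. *)
Definition reroot m w : walg F :=
  let w1 := take (index m w) w in let w2 := drop (index m w).+1 w in
  if w1 == [::] then wd w else - ext (fun v => wd (m :: v ++ w2)) (lie w1).

Lemma lie_reroot m w : m \in w -> lie w = ext lie (reroot m w).
Proof.
move=> mw; rewrite /reroot; case: eqP => [_|/eqP w1n]; first by rewrite ext_wd.
rewrite linearN /= -(ext_lin (ext lie)) /=.
under eq_ext => v _ do rewrite ext_wd.
rewrite -{1}(cat_take_drop (index m w) w) (drop_nth 0%N) ?index_mem // nth_index //.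
rewrite lie_cat //= brkC linearN /= -ext_adw_lie // -(ext_lin (adw _)).
by congr (- _); apply: eq_ext => v _; rewrite /= adw_cat.
Qed.

Lemma msupp_reroot m w v : m \in w -> v \in msupp (reroot m w) ->
  perm_eq v w /\ head 0%N v = m.
Proof.
move=> mw; rewrite /reroot; case: eqP => [w1n|/eqP w1n].
  rewrite msupp_wd inE => /eqP ->; split=> //.
  move: w1n; case: w mw => // x w /=; case: eqP => //.
rewrite msuppN => /msupp_ext[v' /msupp_lie pv].
rewrite msupp_wd inE => /eqP ->; split=> //.
have ew : w = take (index m w) w ++ m :: drop (index m w).+1 w.
  by rewrite -[LHS](cat_take_drop (index m w)) (drop_nth 0%N) ?index_mem ?nth_index.
by rewrite [X in perm_eq _ X]ew -(cat1s m) -[X in perm_eq _ (_ ++ X)]cat1s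
   perm_catCA perm_cat2r.
Qed.

End Lie.

(** * Convolution of bracketings *)

Section Convolution.
Variable F : fieldType.
Implicit Types (a b : walg F) (u v w : seq nat) (U A : seq (seq nat)).
Local Notation wd := (wd F).
Local Notation lie := (lie F).

(* Lie elements are primitive for the coproduct [deshuf]. *)
Lemma ext_deshuf_lie (V : lmodType F) (B : seq nat -> seq nat -> V) u :
  u != [::] ->
  ext (deshuf B) (lie u) = ext (B^~ [::]) (lie u) + ext (B [::]) (lie u).
Proof.
move=> un; move: u un B; apply: lie_ind => [x|u x un IH] B.
  by rewrite !ext_wd deshuf_cons !deshuf_nil.
have deshuf1 (B' : seq nat -> seq nat -> V) : deshuf B' [:: x] = B' [:: x] [::] + B' [::] [:: x].
  by rewrite deshuf_cons !deshuf_nil.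
rewrite lie_rcons // {1}/brk linearB /= !extM ext_wd.
under eq_ext => w _ do rewrite ext_wd deshuf_cat.
rewrite IH; under eq_ext => w _ do rewrite deshuf1 !cats0 /=.
under [X in _ + X - _]eq_ext => w _ do rewrite deshuf1 !cats0 /=.
under [X in _ - X]eq_ext => w _ do rewrite /= deshuf_cons.
rewrite !extDf !IH /brk !linearB /= !extM !ext_wd.
under [X in _ = X - _ + _]eq_ext => w _ do rewrite ext_wd.
under [X in _ = _ + (X - _)]eq_ext => w _ do rewrite ext_wd.
(* The terms that put [x] and [lie u] into different halves cancel in pairs. *)
rewrite !opprD !addrA [LHS](ACl (1*5*4*8*(2*7)*(3*6))) /=.
by rewrite !subrr !addr0.
Qed.

(** The coproduct is multiplicative and every factor is primitive, so each factor goes to one side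
    as a whole: the blocks of [U] are unshuffled like letters. *)
Lemma ext_deshuf_prod (V : lmodType F) (B : seq nat -> seq nat -> V) U :
  [::] \notin U ->
  ext (deshuf B) (\prod_(u <- U) lie u) =
  deshuf (fun S S' => ext (fun u => ext (B u) (\prod_(s <- S') lie s))
                          (\prod_(s <- S) lie s)) U.
Proof.
elim: U B => [|u U IH] B; first by rewrite deshuf_nil !big_nil !ext1 deshuf_nil.
rewrite inE negb_or eq_sym => /andP[un Un]; rewrite big_cons extM.
rewrite (_ : ext _ _ = ext (deshuf (fun x y => ext (deshuf (fun s t =>
    B (x ++ s) (y ++ t))) (\prod_(s <- U) lie s))) (lie u)); last first.
  apply: eq_ext => w _; rewrite [RHS]/deshuf -ext_sumf; apply: eq_ext => w' _.
  by rewrite deshuf_cat.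
rewrite ext_deshuf_lie // deshuf_cons; congr (_ + _).
  under eq_ext => w _ do rewrite IH //.
  rewrite ext_sumf; apply: eq_bigr => p _; rewrite big_cons extM.
  by apply: eq_ext.
under eq_ext => w _ do rewrite IH //.
rewrite ext_sumf; apply: eq_bigr => p _; rewrite exchange_ext.
by apply: eq_ext => w _; rewrite big_cons extM.
Qed.

Definition lie_deg m u : walg F := (size u == m)%:R *: lie u.

(* The action of omega_q on the word w, by act_omega_q below. *)
Fixpoint lieconv (q : seq nat) w : walg F :=
  if q is m :: q' then deshuf (fun u v => lie_deg m u * lieconv q' v) w
  else (w == [::])%:R.

Lemma lieconv_prod_cons m q U : [::] \notin U ->
  ext (lieconv (m :: q)) (\prod_(u <- U) lie u) =
  deshuf (fun S S' => ext (lie_deg m) (\prod_(s <- S) lie s) *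
                      ext (lieconv q) (\prod_(s <- S') lie s)) U.
Proof.
move=> Un; rewrite ext_deshuf_prod //; apply: eq_deshuf => S S'.
by rewrite -ext_mulr; apply: eq_ext => u _; rewrite -ext_mull.
Qed.

Lemma mem_splits_subset (T : eqType) (s : seq T) p : p \in splits s ->
  {subset p.1 <= s} /\ {subset p.2 <= s}.
Proof.
elim: s p => [|x s IH] p /=; first by rewrite inE => /eqP ->.
rewrite mem_cat => /orP[] /mapP[r /IH [h1 h2] ->] /=; split=> y; rewrite !inE.
- by case/orP=> [->|/h1 ->]; rewrite ?orbT.
- by move/h2 ->; rewrite orbT.
- by move/h1 ->; rewrite orbT.
- by case/orP=> [->|/h2 ->]; rewrite ?orbT.
Qed.

(** Every part of [q] is positive and must absorb at least one factor, so too few factors leave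
    nothing. *)
Lemma lieconv_prod0 q U : 0%N \notin q -> [::] \notin U -> (size U < size q)%N ->
  ext (lieconv q) (\prod_(u <- U) lie u) = 0.
Proof.
elim: q U => [|m q IH] U //; rewrite inE negb_or eq_sym => /andP[m0 q0] Un sU.
rewrite lieconv_prod_cons // /deshuf big_seq big1 // => p pU.
have [_ s2] := mem_splits_subset pU; have := mem_splits_size pU.
case: p pU s2 => [[|u S] S'] /= pU s2 sz.
  by rewrite big_nil ext1 /lie_deg eq_sym (negPf m0) scale0r mul0r.
rewrite [X in _ * X]IH ?mulr0 //; first by apply: contra Un => /s2.
by rewrite -ltnS; apply: leq_trans sU; rewrite -sz ltnS addSn ltnS leq_addl.
Qed.

Lemma ext_lie_deg m u : u != [::] ->
  ext (lie_deg m) (lie u) = ((size u == m) * m)%:R *: lie u.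
Proof.
move=> un; rewrite (_ : ext _ _ = (size u == m)%:R *: ext lie (lie u)).
  rewrite ext_lie_lie // scalerA -natrM; congr (_%:R *: _).
  by case: eqP => // ->.
rewrite -(ext_lin ( *:%R (size u == m)%:R)).
by apply: eq_ext => w /msupp_lie /perm_size sw; rewrite /lie_deg sw.
Qed.

(** With as many factors as parts, each part absorbs exactly one factor, of its own degree; the
    Dynkin-Specht-Wever identity contributes the scalar [m] for a part [m]. *)
Lemma lieconv_prod q U : 0%N \notin q -> [::] \notin U -> uniq U -> size U = size q ->
  ext (lieconv q) (\prod_(u <- U) lie u) =
  (\prod_(m <- q) m)%:R *:
  \sum_(A <- permutations U | map size A == q) \prod_(u <- A) lie u.
Proof.
elim: q U => [|m q IH] U.
  case: U => // _ _ _ _; rewrite !big_nil ext1 scale1r.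
  by rewrite big_mkcond /= big_seq1 /= big_nil.
rewrite inE negb_or eq_sym => /andP[m0 q0] Un uU sU.
(* Only splits with one factor in the first half matter: an empty half has degree 0, and a half with
   two or more factors leaves too few for the rest of [q], by [lieconv_prod0]. *)
pose B S S' := if size S == 1%N then ext (lie_deg m) (\prod_(s <- S) lie s) *
                      ext (lieconv q) (\prod_(s <- S') lie s) else 0.
rewrite lieconv_prod_cons // (_ : deshuf _ _ = deshuf B U); last first.
  rewrite /deshuf /B big_seq [RHS]big_seq; apply: eq_bigr => p pU.
  have [_ s2] := mem_splits_subset pU; have := mem_splits_size pU.
  case: p pU s2 => [[|u [|u' S]] S'] //= pU s2 sz.
    by rewrite big_nil ext1 /lie_deg eq_sym (negPf m0) scale0r mul0r.
  rewrite [X in _ * X]lieconv_prod0 ?mulr0 //; first by apply: contra Un => /s2.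
  by move: sz; rewrite sU /= !addSn => -[<-]; rewrite ltnS leq_addl.
rewrite deshuf_oneP //; last by move=> u v; rewrite /B => /negPf ->.
rewrite [X in _ = _ *: X]big_mkcond (perm_big _ (permutationsE _)) /=; last by rewrite sU.
rewrite big_allpairs_dep /= undup_id // scaler_sumr.
apply: eq_big_seq => u inU.
have un : u != [::] by apply: contraNneq Un => <-.
rewrite /B /= big_seq1 ext_lie_deg // IH ?rem_uniq ?size_rem ?sU //; last first.
  by apply: contra Un; exact: mem_rem.
rewrite -big_mkcond big_cons natrM -scalerAl -walg_scalerAr.
case: eqP => [<-|um]; last first.
  rewrite mul0r scale0r big1 ?scaler0 // => A /eqP[/um].
  by [].
rewrite mul1r scalerA mulr_sumr; congr (_ *: _); first by rewrite natrM.
by apply: eq_big => [A|A _]; rewrite ?big_cons // eqseq_cons eqxx.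
Qed.

End Convolution.

(** * Ordered block decompositions *)

Section Blocks.
Variable T : eqType.
Implicit Types (P : pred (seq T)) (q : seq nat) (w u b : seq T) (B : seq (seq T)).

Lemma splits_perm w p : p \in splits w -> perm_eq (p.1 ++ p.2) w.
Proof.
elim: w p => [|x w IH] p /=; first by rewrite inE => /eqP ->.
rewrite mem_cat => /orP[] /mapP[r /IH rs -> /=]; first by rewrite perm_cons.
by rewrite -[x :: r.2]cat1s perm_catCA /= perm_cons.
Qed.

Lemma mem_splits w (a : pred T) : (filter a w, filter (predC a) w) \in splits w.
Proof.
elim: w => [|x w IH] //=; rewrite mem_cat.
case: (a x) => /=; apply/orP; [left|right].
  by apply/mapP; exists (filter a w, filter (predC a) w).
by apply/mapP; exists (filter a w, filter (predC a) w).
Qed.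

(** When the letters are distinct, a split is determined by the set of letters of its first half. *)
Lemma splits_filter w p : uniq w -> p \in splits w ->
  p.1 = filter (mem p.1) w /\ p.2 = filter (predC (mem p.1)) w.
Proof.
elim: w p => [|x w IH] p /=; first by rewrite inE => _ /eqP ->.
case/andP=> xw uw; rewrite mem_cat => /orP[] /mapP[r rw -> /=].
all: have [e1 e2] := IH _ uw rw; have pr := splits_perm rw.
all: have xr : x \notin r.1 ++ r.2 by rewrite (perm_mem pr).
all: move: xr; rewrite mem_cat negb_or => /andP[xr1 xr2].
  rewrite inE eqxx /=; split.
    congr cons; rewrite {1}e1; apply: eq_in_filter => y yw /=.
    by rewrite inE; case: eqP => // yx; rewrite -yx yw in xw.
  rewrite {1}e2; apply: eq_in_filter => y yw /=.
  by rewrite inE; case: eqP => // yx; rewrite -yx yw in xw.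
by rewrite (negPf xr1) /=; split=> //; congr cons.
Qed.

Lemma splits_uniq w : uniq w -> uniq (splits w).
Proof.
elim: w => [|x w IH] //= /andP[xw uw]; rewrite cat_uniq !map_inj_uniq ?IH //=.
- rewrite andbT; apply/hasPn => _ /mapP[r rw ->]; apply/mapP => -[r' _ [e _]].
  have := splits_perm rw; rewrite e /= => /perm_mem /(_ x).
  by rewrite (negPf xw) inE eqxx.
- by move=> [? ?] [? ?] [-> ->].
- by move=> [? ?] [? ?] [-> ->].
Qed.

(** Two choices of [P] are used: being a subword of a given word, which yields the terms of
    [lieconv], and starting with the minimum, which yields the rewritten expansion. *)
Definition blocks P q w : seq (seq (seq T)) :=
  [seq B <- [seq reshape q w' | w' <- permutations w] | all P B].

Lemma mem_blocks P q w B : sumn q = size w ->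
  (B \in blocks P q w) = [&& map size B == q, perm_eq (flatten B) w & all P B].
Proof.
move=> sq; rewrite mem_filter andbC andbA; congr (_ && _).
apply/mapP/andP=> [[w']|[/eqP sB pB]].
  rewrite mem_permutations => pw ->; have sw := perm_size pw.
  by rewrite -/(shape _) reshapeKl ?reshapeKr ?sw ?sq.
by exists (flatten B); rewrite ?mem_permutations // -sB flattenK.
Qed.

Lemma blocks_uniq P q w : sumn q = size w -> uniq (blocks P q w).
Proof.
move=> sq; apply: filter_uniq; rewrite map_inj_in_uniq ?permutations_uniq //.
move=> u v; rewrite !mem_permutations => /perm_size su /perm_size sv e.
by rewrite -[u](@reshapeKr _ q) ?sq ?su // e reshapeKr ?sq ?sv.
Qed.

(** A decomposition amounts to a choice of the letters of the first block (a split), an ordering of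
    them, and a decomposition of the remaining letters. This follows the recursion of [lieconv]. *)
Lemma blocks_cons P m q w : uniq w -> (m + sumn q = size w)%N ->
  perm_eq (blocks P (m :: q) w)
    [seq t.1 :: t.2 | p <- [seq p <- splits w | size p.1 == m],
       t <- [seq (b, B) | b <- filter P (permutations p.1), B <- blocks P q p.2]].
Proof.
move=> uw sw; set r := filter _ _.
have rw p : p \in r -> [/\ p \in splits w, size p.1 = m & sumn q = size p.2].
  rewrite mem_filter => /andP[/eqP sp pw]; split=> //.
  by move: (mem_splits_size pw); rewrite -sw sp => /addnI.
apply: uniq_perm; first exact: blocks_uniq.
  apply: allpairs_uniq_dep; first by rewrite filter_uniq ?splits_uniq.
    move=> p /rw[pw sp sq]; apply: allpairs_uniq => [||[? ?] [? ?] _ _ [-> ->]] //.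
      by rewrite filter_uniq ?permutations_uniq.
    exact: blocks_uniq.
  move=> x x' /allpairsPdep[p [t [/rw[pw _ _] /allpairsP[[b B] /= [bp _ ->]] ->]]].
  case/allpairsPdep=> [p' [t' [/rw[pw' _ _] /allpairsP[[b' B'] /= [bp' _ ->]] ->]]] /=.
  case=> eb <-; subst b'.
  move: bp bp'; rewrite !mem_filter !mem_permutations => /andP[_ bp] /andP[_ bp'].
  have [e1 e2] := splits_filter uw pw; have [e1' e2'] := splits_filter uw pw'.
  (* The first block has the letters of the first half, and these determine the split. *)
  have ep : p.1 =i p'.1 by move=> y; rewrite -(perm_mem bp) (perm_mem bp').
  suff -> : p = p' by [].
  rewrite [p]surjective_pairing [p']surjective_pairing.
  by congr pair; [rewrite [LHS]e1 [RHS]e1' | rewrite [LHS]e2 [RHS]e2']; apply: eq_filter => y /=; rewrite ep.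
move=> B; rewrite mem_blocks //=; apply/and3P/allpairsPdep.
  case: B => [|b B]; first by case.
  case=> /eqP[sb sB] pB /andP[Pb PB]; pose a := mem b.
  exists (filter a w, filter (predC a) w), (b, B).
  have uB : uniq (b ++ flatten B) by rewrite (perm_uniq pB).
  have p1 : perm_eq b (filter a w).
    apply: uniq_perm; rewrite ?filter_uniq //; first by move: uB; rewrite cat_uniq => /and3P[].
    move=> y; rewrite mem_filter /= -(perm_mem pB) /= mem_cat.
    by case: (y \in b).
  have p2 : perm_eq (flatten B) (filter (predC a) w).
    rewrite -(perm_cat2l b) (permPl pB) perm_sym (permPl (perm_cat p1 (perm_refl _))).
    by rewrite perm_filterC.
  split=> //; first by rewrite mem_filter mem_splits andbT /= -(perm_size p1) sb.
  apply/allpairsP; exists (b, B); split=> //=.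
    by rewrite mem_filter Pb mem_permutations.
  rewrite mem_blocks ?sB ?eqxx ?p2 //.
  by rewrite -(perm_size p2) size_flatten /shape sB.
case=> p [t [/rw[pw sp sq] /allpairsP[[b B'] /= [bp BB ->]] ->]] /=.
move: bp BB; rewrite mem_filter mem_permutations mem_blocks //.
case/andP=> Pb bp /and3P[/eqP sB pB PB]; split; last by rewrite Pb.
  by rewrite sB (perm_size bp) sp.
by rewrite -(permPr (splits_perm pw)); apply: perm_cat.
Qed.

Lemma big_blocks_cons (R : Type) (idx : R) (op : Monoid.com_law idx)
    (G : seq (seq T) -> R) P m q w :
  uniq w -> (m + sumn q = size w)%N ->
  \big[op/idx]_(B <- blocks P (m :: q) w) G B =
  \big[op/idx]_(p <- splits w | size p.1 == m)
    \big[op/idx]_(b <- permutations p.1 | P b)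
      \big[op/idx]_(B <- blocks P q p.2) G (b :: B).
Proof.
move=> uw sw; rewrite (perm_big _ (blocks_cons P uw sw)) /= big_allpairs_dep /=.
rewrite big_filter; apply: eq_bigr => p _; rewrite big_allpairs_dep /=.
by rewrite big_filter.
Qed.

Lemma blocks_nil P : blocks P [::] [::] = [:: [::]].
Proof. by []. Qed.

Lemma splits_count w m : count (fun p => size p.1 == m) (splits w) = 'C(size w, m).
Proof.
elim: w m => [|x w IH] m; first by case: m.
rewrite /= count_cat !count_map; case: m => [|m].
  by rewrite bin0 (eq_count (a2 := pred0)) // count_pred0 -(bin0 (size w)) -IH.
by rewrite binS addnC -!IH.
Qed.

Lemma splits_sumn w p m q : (m + sumn q = size w)%N -> p \in splits w ->
  size p.1 = m -> sumn q = size p.2.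
Proof. by move=> sw pw sp; move: (mem_splits_size pw); rewrite -sw sp => /addnI. Qed.

Lemma splits_uniq2 w p : uniq w -> p \in splits w -> uniq p.1 /\ uniq p.2.
Proof.
by move=> uw /splits_perm /perm_uniq; rewrite uw cat_uniq => /and3P[].
Qed.

End Blocks.

(** * Words that start with their minimum, and their number *)

Definition minfirst (b : seq nat) := all (fun x => (head 0%N b <= x)%N) b.

Lemma mem_min_seq (u : seq nat) : u != [::] ->
  exists2 m, m \in u & all (leq m) u.
Proof.
elim: u => // x u IH _; case: (eqVneq u [::]) => [->|/IH [m mu am]].
  by exists x; rewrite ?inE //= leqnn.
case: (leqP x m) => xm.
  exists x; rewrite ?inE ?eqxx //= leqnn /=; apply/allP => y /(allP am).
  exact: leq_trans.
by exists m; rewrite ?inE ?mu ?orbT //= am (ltnW xm).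
Qed.

Lemma minfirst_head m u b : perm_eq b u -> m \in u -> all (leq m) u ->
  minfirst b = (head 0%N b == m).
Proof.
move=> bu mu am; apply/idP/eqP=> [mb|hb].
  apply/eqP; rewrite eqn_leq (allP mb) ?(perm_mem bu) //= (allP am) //.
  by rewrite -(perm_mem bu); case: b bu {mb} => [/perm_size/esym/size0nil u0|x b _];
     [rewrite u0 in mu | exact: mem_head].
by rewrite /minfirst hb (perm_all _ bu).
Qed.

(** The first letter is forced and the others are free. *)
Lemma count_minfirst (u : seq nat) : uniq u -> u != [::] ->
  count minfirst (permutations u) = ((size u).-1)`!.
Proof.
move=> uu un; have [m mu am] := mem_min_seq un.
rewrite (@eq_in_count _ _ (fun b => head 0%N b == m)); last first.
  by move=> b; rewrite mem_permutations => bu; exact: minfirst_head bu mu am.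
have su : (0 < size u)%N by case: u un {uu mu am}.
rewrite -sum1_count big_mkcond (perm_big _ (permutationsE su)) /= big_allpairs_dep /=.
rewrite undup_id // (bigD1_seq m) //= [X in (_ + X)%N]big1 ?addn0 => [|x /negPf xm]; last first.
  by rewrite big1 // => t _; rewrite xm.
rewrite eqxx sum1_size size_permutations ?rem_uniq //.
by rewrite size_rem.
Qed.

(** A block of length [m] has [(m-1)!] admissible orderings instead of [m!], so the factor [m]
    restores the count of all orderings; the letters of the block are chosen in binomially many
    ways. *)
Lemma size_blocks_minfirst q w : uniq w -> 0%N \notin q -> sumn q = size w ->
  (\prod_(m <- q) m * size (blocks minfirst q w) = (size w)`!)%N.
Proof.
elim: q w => [|m q IH] w uw.
  by move=> _ /esym/size0nil ->; rewrite big_nil.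
rewrite inE negb_or eq_sym => /andP[m0 q0] sw.
rewrite -sum1_size (big_blocks_cons _ _ _ uw sw) big_cons.
rewrite mulnAC -mulnA big_distrl /= -big_filter.
rewrite (eq_big_seq (fun=> ((m.-1)`! * (size w - m)`!))%N) => [|p]; last first.
  rewrite mem_filter => /andP[/eqP sp pw].
  have [u1 u2] := splits_uniq2 uw pw; have sq := splits_sumn sw pw sp.
  have -> : (size w - m = size p.2)%N by rewrite -sw addKn.
  rewrite -(IH _ u2) // -{1}sp -(count_minfirst u1) -?size_eq0 ?sp //.
  under eq_bigr => b _ do rewrite sum1_size.
  rewrite big_const_seq iter_addn_0.
  by rewrite mulnAC mulnC [X in (_ * X)%N]mulnC.
rewrite big_const_seq iter_addn_0 count_predT size_filter splits_count.
rewrite !mulnA -{1}(prednK (n := m)) ?lt0n // -factS prednK ?lt0n //.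
by rewrite mulnC bin_fact // -sw leq_addr.
Qed.

(** * Rewriting convolutions in brackets of words that start with their minimum *)

Section Expansion.
Variable F : fieldType.
Implicit Types (a : walg F) (u v w b q : seq nat).
Local Notation lie := (lie F).
Local Notation lieconv := (lieconv F).

Lemma ext_seq (V : lmodType F) (f : seq nat -> V) a (r : seq (seq nat)) :
  uniq r -> {subset msupp a <= r} -> ext f a = \sum_(w <- r) a@_w *: f w.
Proof.
move=> ur sr; rewrite (bigID (mem (msupp a))) /= [X in _ + X]big1 ?addr0.
  rewrite -big_filter; apply: perm_big; apply: uniq_perm; rewrite ?filter_uniq //.
  by move=> w; rewrite mem_filter /=; case: (boolP (w \in msupp a)) => // /sr.
by move=> w /mcoeff_outdom ->; rewrite scale0r.
Qed.

Lemma walg_scaleM (c d : F) (a a' : walg F) :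
  (c *: a) * (d *: a') = (c * d) *: (a * a').
Proof. by rewrite -scalerAl -walg_scalerAr scalerA. Qed.

Lemma lieconv_cons m q w :
  lieconv (m :: q) w = \sum_(p <- splits w | size p.1 == m) lie p.1 * lieconv q p.2.
Proof.
rewrite big_mkcond; apply: eq_bigr => p _; rewrite /lie_deg.
by case: eqP => _; rewrite ?scale1r // scale0r mul0r.
Qed.

(** A set of letters of [w0] carries exactly one subword of [w0], so a split offers one admissible
    first block. The ambient word [w0] stays fixed so that the condition on blocks survives the
    recursion. *)
Lemma lieconv_blocks q w w0 : uniq w0 -> subseq w w0 -> sumn q = size w ->
  lieconv q w = \sum_(B <- blocks (fun b => subseq b w0) q w) \prod_(b <- B) lie b.
Proof.
move=> u0; elim: q w => [|m q IH] w s0 sw.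
  by move/esym/size0nil: sw => ->; rewrite blocks_nil big_seq1 big_nil.
have uw := subseq_uniq s0 u0.
rewrite lieconv_cons (big_blocks_cons _ _ _ uw sw).
rewrite -[LHS]big_filter -[RHS]big_filter; apply: eq_big_seq => p.
rewrite mem_filter => /andP[/eqP sp pw].
have [e1 e2] := splits_filter uw pw.
have s1 : subseq p.1 w0 by apply: subseq_trans s0; rewrite e1 filter_subseq.
have s2 : subseq p.2 w0 by apply: subseq_trans s0; rewrite e2 filter_subseq.
(* Among the rearrangements of [p.1], only [p.1] itself is a subword of [w0]. *)
rewrite -big_filter (_ : filter _ _ = [:: p.1]) ?big_seq1.
  rewrite (IH _ s2 (splits_sumn sw pw sp)) mulr_sumr.
  by apply: eq_bigr => B _; rewrite big_cons.
apply: perm_small_eq => //; apply: uniq_perm => //.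
  by rewrite filter_uniq ?permutations_uniq.
move=> b; rewrite mem_filter mem_permutations inE; apply/andP/eqP => [[sb pb]|->] //.
have := subseq_uniqP u0 sb; have := subseq_uniqP u0 s1 => -> ->.
by apply: eq_filter => y /=; rewrite (perm_mem pb).
Qed.

(* The coefficient of lie b in the bracket of the subword of w on the letters of
   b: it does not depend on the decomposition of w to which b belongs. *)
Definition mincoef w b : F := (reroot F (head 0%N b) [seq x <- w | x \in b])@_b.

(** Rerooting at the minimum of [u] leaves only words that start with it. As [u] is the subword of
    [w] on its own letters, the coefficients can be read off [w]. *)
Lemma lie_minfirst w u : uniq w -> u != [::] -> u = [seq x <- w | x \in u] ->
  lie u = \sum_(b <- permutations u | minfirst b) mincoef w b *: lie b.
Proof.
move=> uw un eu; have [m mu am] := mem_min_seq un.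
rewrite (lie_reroot F mu) (@ext_seq _ _ _ (filter minfirst (permutations u))); first last.
- move=> v /(msupp_reroot mu)[pv hv]; rewrite mem_filter mem_permutations pv andbT.
  by rewrite (minfirst_head pv mu am) hv.
- by rewrite filter_uniq ?permutations_uniq.
rewrite -[RHS]big_filter; apply: eq_big_seq => b.
rewrite mem_filter mem_permutations => /andP[mb bu].
rewrite /mincoef; move: mb; rewrite (minfirst_head bu mu am) => /eqP ->.
have -> // : [seq x <- w | x \in b] = u.
by rewrite [RHS]eu; apply: eq_filter => y; rewrite (perm_mem bu).
Qed.

(** Each bracket is rewritten by [lie_minfirst]. The point is the form of the coefficient: a product
    over the blocks, which ignores their order. *)
Lemma lieconv_minfirst q w : uniq w -> 0%N \notin q -> sumn q = size w ->
  lieconv q w = \sum_(B <- blocks minfirst q w)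
    (\prod_(b <- B) mincoef w b) *: \prod_(b <- B) lie b.
Proof.
elim: q w => [|m q IH] w uw q0 sw.
  by move/esym/size0nil: sw => ->; rewrite blocks_nil big_seq1 !big_nil scale1r.
move: q0; rewrite inE negb_or eq_sym => /andP[m0 q0].
rewrite lieconv_cons (big_blocks_cons _ _ _ uw sw).
rewrite -[LHS]big_filter -[RHS]big_filter; apply: eq_big_seq => p.
rewrite mem_filter => /andP[/eqP sp pw].
have [e1 e2] := splits_filter uw pw; have [u1 u2] := splits_uniq2 uw pw.
have sq := splits_sumn sw pw sp.
rewrite (lie_minfirst uw _ e1) -?size_eq0 ?sp // mulr_suml.
apply: eq_bigr => b _; rewrite IH // mulr_sumr; apply: eq_big_seq => B.
rewrite mem_blocks // => /and3P[_ pB _].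
(* The blocks of [B] use only letters of [p.2], and restricting [w] or [p.2] to such a block gives
   the same subword. *)
have -> : \prod_(b' <- B) mincoef p.2 b' = \prod_(b' <- B) mincoef w b'; last first.
  rewrite [X in _ = X *: _]big_cons [X in _ = _ *: X]big_cons.
  exact: walg_scaleM.
apply: eq_big_seq => b' b'B; rewrite /mincoef.
suff -> : [seq x <- p.2 | x \in b'] = [seq x <- w | x \in b'] by [].
rewrite e2 -filter_predI; apply: eq_in_filter => y yw /=.
case: (boolP (y \in b')) => //= yb.
have : y \in p.2 by rewrite -(perm_mem pB); apply/flattenP; exists b'.
by rewrite e2 mem_filter /= => /andP[->].
Qed.

Lemma msupp_prod_lie (A : seq (seq nat)) w :
  w \in msupp (\prod_(u <- A) lie u) -> size w = sumn (map size A).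
Proof.
elim: A w => [|u A IH] w; first by rewrite big_nil msupp_wd inE => /eqP ->.
rewrite big_cons => /msuppM_le[w1 [w2 [/msupp_lie/perm_size h1 /IH h2 ->]]].
by rewrite [LHS]size_cat h1 h2.
Qed.

(** Equal lengths make the coefficient a product over blocks. Two blocks with the same letters share
    their minimum as first letter, and [coef_lie_head] then compares the rest. *)
Lemma coef_prod_lie (A U : seq (seq nat)) :
  map size A = map size U -> [::] \notin U -> all uniq A -> all uniq U ->
  all minfirst A -> all minfirst U ->
  (\prod_(u <- A) lie u)@_(flatten U) = (A == U)%:R.
Proof.
elim: A U => [|u A IH] [|v U] //= sz; first by move=> *; rewrite big_nil -wd_nil coef_wd.
rewrite inE negb_or eq_sym => /andP[vn Un] /andP[uu uA] /andP[uv uU].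
case/andP=> mu mA /andP[mv mU]; case: sz => suv sAU.
rewrite big_cons coefM_split; last first.
  by move=> w /msupp_lie/perm_size ->.
rewrite IH // eqseq_cons -mulnb natrM; congr (_ * _).
have [puv|npuv] := boolP (perm_eq v u); last first.
  rewrite mcoeff_outdom; last by apply: contra npuv => /msupp_lie.
  by have [euv|//] := eqVneq u v; rewrite euv perm_refl in npuv.
case: v u suv vn uu uv mu mv puv => [//|x v] [//|y u] _ _ uu uv mu mv puv.
have exy : x = y.
  apply/eqP; rewrite eqn_leq (allP mv) /=; last by rewrite (perm_mem puv) mem_head.
  by rewrite (allP mu) // -(perm_mem puv) mem_head.
subst y; rewrite coef_lie_head; last by case/andP: uu.
by rewrite eqseq_cons eqxx.
Qed.

End Expansion.

(** * The action of the group algebra on words *)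

Lemma permnE n f : injective (@ofun n f) -> permn n f =1 @ofun n f.
Proof.
move=> inj_f x; rewrite /permn; set E := erefl; move: E.
case: {2 3}(injectiveb (ofun f)) => E; first by rewrite permE.
by move/injectiveP: inj_f; rewrite E.
Qed.

Lemma val_ofun n (f : nat -> nat) (i : 'I_n) : (f i < n)%N -> val (ofun f i) = f i.
Proof. by move=> fn; rewrite /ofun insubdK. Qed.

Lemma appn_ord n (s : 'S_n) (i : 'I_n) : appn s i = s i.
Proof. by rewrite /appn valK. Qed.

Lemma appn_lt n (s : 'S_n) i : (i < n)%N -> (appn s i < n)%N.
Proof. by move=> lin; rewrite -[i]/(val (Ordinal lin)) appn_ord. Qed.

Lemma appn_permn n f i : (forall j, j < n -> f j < n)%N ->
  (forall j k, j < n -> k < n -> f j = f k -> j = k)%N ->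
  (i < n)%N -> appn (permn n f) i = f i.
Proof.
move=> fn injf lin; rewrite -[i]/(val (Ordinal lin)) appn_ord permnE ?val_ofun ?fn //.
by move=> j k /(congr1 val); rewrite !val_ofun ?fn // => /injf e; apply: val_inj; apply: e.
Qed.

Lemma size_wact n (s : 'S_n) w : size (wact s w) = n.
Proof. by rewrite size_map size_enum_ord. Qed.

Lemma nth_wact n (s : 'S_n) w i : (i < n)%N ->
  nth 0%N (wact s w) i = nth 0%N w (appn s i).
Proof.
move=> lin; rewrite -[i in LHS]/(val (Ordinal lin)) (nth_map (Ordinal lin)) ?size_enum_ord //.
by rewrite nth_ord_enum -(appn_ord s (Ordinal lin)).
Qed.

Lemma wactE n (s : 'S_n) w : wact s w = map (nth 0%N w) (map (appn s) (iota 0 n)).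
Proof.
by rewrite /wact -val_enum_ord -!map_comp; apply: eq_map => i /=; rewrite appn_ord.
Qed.

Lemma wactM n (s t : 'S_n) w : wact (s * t)%g w = wact s (wact t w).
Proof.
by rewrite /wact; apply: eq_map => i; rewrite permM -(appn_ord t) nth_wact.
Qed.

Lemma wact1 n w : size w = n -> wact (1%g : 'S_n) w = w.
Proof.
move=> sw; apply: (@eq_from_nth _ 0%N); rewrite size_wact // => i lin.
by rewrite nth_wact // -[i in appn _ i]/(val (Ordinal lin)) appn_ord perm1.
Qed.

Lemma perm_map_enum n (s : 'S_n) : perm_eq (map s (enum 'I_n)) (enum 'I_n).
Proof.
apply: uniq_perm; rewrite ?(map_inj_uniq perm_inj) ?enum_uniq // => i.
rewrite mem_enum; apply/mapP; exists (s^-1%g i); rewrite ?mem_enum //.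
by rewrite permKV.
Qed.

Lemma wact_perm n (s : 'S_n) w : size w = n -> perm_eq (wact s w) w.
Proof.
move=> sw; rewrite -[X in perm_eq _ X](wact1 sw) /wact.
rewrite (map_comp (fun i : 'I_n => nth 0%N w i) s).
apply: perm_trans (perm_map _ (perm_map_enum s)) _.
suff -> : [seq nth 0%N w ((1%g : 'S_n) i) | i <- enum 'I_n]
        = [seq nth 0%N w (val i) | i <- enum 'I_n] by [].
by apply: eq_map => i; rewrite perm1.
Qed.

Section Action.
Variable F : fieldType.
Implicit Types (w : seq nat).
Local Notation wd := (wd F).
Local Notation lie := (lie F).
Local Notation lieconv := (lieconv F).

Definition act n (a : galg F n) w : walg F := \sum_(s : 'S_n) a s *: wd (wact s w).

Lemma actD n (a b : galg F n) w : act (a + b) w = act a w + act b w.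
Proof. by rewrite -big_split; apply: eq_bigr => s _; rewrite ffunE scalerDl. Qed.

Lemma actN n (a : galg F n) w : act (- a) w = - act a w.
Proof. by rewrite -sumrN; apply: eq_bigr => s _; rewrite ffunE scaleNr. Qed.

Lemma act0 n w : act (0 : galg F n) w = 0.
Proof. by rewrite /act big1 // => s _; rewrite ffunE scale0r. Qed.

Lemma act_sum n (I : Type) (r : seq I) (P : pred I) (f : I -> galg F n) w :
  act (\sum_(i <- r | P i) f i) w = \sum_(i <- r | P i) act (f i) w.
Proof. by apply: (big_morph (act (n:=n) ^~ w)) => [a b|]; [exact: actD | exact: act0]. Qed.

Lemma act_scale n c (a : galg F n) w : act (gscale c a) w = c *: act a w.
Proof. by rewrite /act scaler_sumr; apply: eq_bigr => s _; rewrite ffunE scalerA. Qed.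

Lemma act_delta n (s : 'S_n) w : act (gdelta F s) w = wd (wact s w).
Proof.
rewrite /act (bigD1 s) //= ffunE eqxx scale1r big1 ?addr0 // => t /negPf ts.
by rewrite ffunE ts scale0r.
Qed.

Lemma gmulE n (a b : galg F n) s : gmul a b s = \sum_t a t * b (t^-1 * s)%g.
Proof. exact: ffunE. Qed.

(** [wact] is a left action, so the right factor acts first. *)
Lemma act_gmul n (a b : galg F n) w : act (gmul a b) w = ext (act a) (act b w).
Proof.
rewrite [act b w]/act linear_sum /=.
under [RHS]eq_bigr => s _ do rewrite linearZ /= ext_wd.
rewrite /act; under [LHS]eq_bigr => s _ do rewrite gmulE scaler_suml.
rewrite exchange_big /=; under [RHS]eq_bigr => s _ do rewrite scaler_sumr.
rewrite [RHS]exchange_big /=; apply: eq_bigr => t _.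
rewrite (reindex_inj (mulgI t)) /=; apply: eq_bigr => s _.
by rewrite mulKg wactM scalerA mulrC.
Qed.

Lemma act_one n w : size w = n -> act (gone F n) w = wd w.
Proof. by move=> sw; rewrite act_delta wact1. Qed.

(** Hence [1 - c_k] with [k = size u + 1] sends [u x d] to [u x d - x u d], the bracket of [u] with
    [x] followed by [d]. *)
Lemma wact_cyc m (u d : seq nat) x : u != [::] -> size (u ++ x :: d) = m ->
  wact (cyc m (size u).+1) (u ++ x :: d) = x :: u ++ d.
Proof.
move=> un sm; move: (sm); rewrite size_cat /= => sm'.
have su : (0 < size u)%N by case: u un {sm sm'}.
apply: (@eq_from_nth _ 0%N); first by rewrite size_wact -sm !size_cat /= size_cat addnS.
move=> i; rewrite size_wact => lim; rewrite nth_wact // /cyc appn_permn //; first last.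
- by move=> j k jm km; repeat case: ifP => ?; lia.
- by move=> j jm; repeat case: ifP => ?; lia.
case: i lim => [|i] lim /=; first by rewrite nth_cat ltnn subnn.
case: ltnP => iu; rewrite !nth_cat; first by rewrite -ltnS iu.
have -> : (i < size u)%N = false by lia.
have -> : (i.+1 < size u)%N = false by lia.
by have -> : (i.+1 - size u = (i - size u).+1)%N by lia.
Qed.

Lemma act_omega w : act (omega F (size w)) w = lie w.
Proof.
(* The [k] rightmost factors [1 - c_(k+1)], ..., [1 - c_2] act first; they bracket the first [k + 1]
   letters and leave the rest untouched. *)
suff H k : (k < size w)%N ->
    act (foldr (@gmul F (size w)) (gone F (size w))
      [seq gone F (size w) - gdelta F (cyc (size w) i) | i <- rev (iota 2 k)]) w =
    lie (take k.+1 w) * wd (drop k.+1 w).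
  rewrite /omega; case: (eqVneq w [::]) => [->|wn]; first by rewrite act_one.
  have sw : (0 < size w)%N by rewrite lt0n size_eq0.
  by rewrite H prednK // take_size drop_size mulr1.
elim: k => [|k IH] kw.
  rewrite act_one //; case: w kw => // x w _; rewrite /= take0 drop0.
  by rewrite wdM.
have -> : iota 2 k.+1 = iota 2 k ++ [:: k.+2] by rewrite -[k.+1 in LHS]addn1 iotaD.
rewrite rev_cat /= act_gmul IH ?(ltnW kw) //.
rewrite extM (drop_nth 0%N) //; set x := nth _ _ _; set t := take _ _; set d := drop _ _.
have -> : take k.+2 w = rcons t x by rewrite (take_nth 0%N).
have st : size t = k.+1 by rewrite size_take kw.
have tn : t != [::] by rewrite -size_eq0 st.
rewrite -/d lie_rcons // /brk mulrBl -!mulrA !wdM.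
have H u : u \in msupp (lie t) ->
    ext (fun v => act (gone F (size w) - gdelta F (cyc (size w) k.+2)) (u ++ v)) (wd (x :: d))
    = wd u * wd (x :: d) + - wd [:: x] * (wd u * wd d).
  move=> ut; have su : size u = k.+1 by rewrite (perm_size (msupp_lie ut)).
  have un : u != [::] by rewrite -size_eq0 su.
  have sm : size (u ++ x :: d) = size w.
    by rewrite size_cat su -st -(size_cat t) -(drop_nth 0%N kw) cat_take_drop.
  rewrite ext_wd actD actN act_one // act_delta -su wact_cyc //.
  by rewrite mulNr !wdM.
by rewrite (eq_ext H) extDf ext_mulr ext_mull ext_mulr ext_id mulNr.
Qed.

End Action.

Lemma appn_inj n (s : 'S_n) i j : (i < n)%N -> (j < n)%N ->
  appn s i = appn s j -> i = j.
Proof.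
move=> li lj; rewrite -[i]/(val (Ordinal li)) -[j]/(val (Ordinal lj)) !appn_ord.
by move/val_inj/perm_inj => ->.
Qed.

Lemma wact_shiftp n m (s : 'S_m) (w1 w2 w3 : seq nat) :
  size w2 = m -> (size w1 + m + size w3 = n)%N ->
  wact (shiftp n (size w1) s) (w1 ++ w2 ++ w3) = w1 ++ wact s w2 ++ w3.
Proof.
move=> s2 sn; apply: (@eq_from_nth _ 0%N).
  by rewrite size_wact !size_cat size_wact; lia.
move=> i; rewrite size_wact => lin; rewrite nth_wact // /shiftp appn_permn //; first last.
- move=> j k jn kn; case: ifP => hj; case: ifP => hk.
  + move/addnI/appn_inj => h; have : (j - size w1 = k - size w1)%N by apply: h; lia.
    by lia.
  + have := @appn_lt _ s (j - size w1); lia.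
  + have := @appn_lt _ s (k - size w1); lia.
  + by [].
- move=> j jn; case: ifP => // hj; have := @appn_lt _ s (j - size w1); lia.
have [i1|i1] := ltnP i (size w1); first by rewrite /= !nth_cat i1.
have [i2|i2] := ltnP i (size w1 + m).
  have am : (appn s (i - size w1) < m)%N by apply: appn_lt; lia.
  have im : (i - size w1 < m)%N by lia.
  rewrite /= !nth_cat ltnNge leq_addr addKn s2 am /=.
  by rewrite ltnNge i1 size_wact im nth_wact.
by rewrite /= !nth_cat ltnNge i1 size_wact s2 /=; case: ltnP => //; lia.
Qed.

Lemma reshape_map (S T : Type) (f : S -> T) sh s :
  reshape sh (map f s) = map (map f) (reshape sh s).
Proof. by elim: sh s => //= m sh IH s; rewrite -map_take -map_drop IH. Qed.

(** * Descents and cuts into subwords *)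

Definition cuts (q : seq nat) := [seq qplus q j | j <- iota 1 (size q)].

Lemma cuts_cons m q : cuts (m :: q) = m :: map (addn m) (cuts q).
Proof.
rewrite /cuts /= /qplus /= take0 addn0; congr cons.
rewrite -map_comp (iotaDl 1 1) -map_comp; by apply: eq_map => j /=; rewrite add0n.
Qed.

(** Positions count from 1, so position [i] compares the entries with indices [i - 1] and [i]; the
    cuts are exactly the positions where two blocks meet, together with the end of [t]. *)
Lemma sorted_reshape q t : 0%N \notin q -> sumn q = size t ->
  all (sorted ltn) (reshape q t) <->
  (forall i, 0 < i < size t -> i \notin cuts q -> nth 0 t i.-1 < nth 0 t i)%N.
Proof.
elim: q t => [|m q IH] t; first by move=> _ /esym/size0nil ->; split=> //= _ [|i].
rewrite inE negb_or eq_sym => /andP[m0 q0] /= st.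
have stm : size (take m t) = m by rewrite size_take; case: ltnP => //; lia.
have std : sumn q = size (drop m t) by rewrite size_drop -st addKn.
rewrite cuts_cons; split.
  case/andP=> /(sortedP 0%N) s1 /(IH _ q0 std) s2 i /andP[i0 it].
  rewrite inE negb_or => /andP[im iq]; case: (ltnP i m) => lim.
    have := s1 i.-1; rewrite prednK // stm !nth_take ?(leq_ltn_trans (leq_pred i)) //.
    by apply.
  have := s2 (i - m)%N; rewrite !nth_drop size_drop.
  have -> : (m + (i - m) = i)%N by lia.
  have -> : (m + (i - m).-1 = i.-1)%N by lia.
  apply; first by lia.
  by apply: contra iq => iq; apply/mapP; exists (i - m)%N; rewrite // subnKC.
move=> H; apply/andP; split.
  apply/(sortedP 0%N) => i; rewrite stm => im; rewrite !nth_take ?(ltnW im) //.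
  apply: (H i.+1); first by rewrite -st; lia.
  rewrite inE negb_or; apply/andP; split; first by lia.
  by apply/mapP => -[j _]; lia.
apply/(IH _ q0 std) => i; rewrite size_drop => il iq; rewrite !nth_drop.
have := H (m + i)%N; rewrite (_ : (m + i).-1 = m + i.-1)%N; last by lia.
apply; first by lia.
rewrite inE negb_or; apply/andP; split; first by lia.
by apply: contra iq => /mapP[j jq /addnI ->].
Qed.

Lemma subseq_map_nth (w c : seq nat) : uniq w -> all (gtn (size w)) c ->
  subseq (map (nth 0%N w) c) w = sorted ltn c.
Proof.
move=> uw cw; have ew : w = map (nth 0%N w) (iota 0 (size w)).
  by rewrite map_nth_iota0 // take_size.
apply/idP/idP => [sw|sc].
  have : subseq (map (index^~ w) (map (nth 0%N w) c)) (map (index^~ w) w).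
    exact: map_subseq.
  rewrite -map_comp map_id_in; last by move=> i /(allP cw) /= iw; rewrite index_uniq.
  rewrite [X in subseq _ (map _ X)]ew -map_comp map_id_in; last first.
    by move=> i; rewrite mem_iota /= => iw; rewrite index_uniq.
  move/(subseq_sorted ltn_trans); apply; exact: iota_ltn_sorted.
rewrite {2}ew; apply: map_subseq.
rewrite (_ : c = filter (mem c) (iota 0 (size w))) ?filter_subseq //.
apply: (irr_sorted_eq ltn_trans ltnn) => //.
  by apply: sorted_filter; [exact: ltn_trans | exact: iota_ltn_sorted].
by move=> i; rewrite mem_filter mem_iota add0n /=; case: (boolP (i \in c)) => //= /(allP cw) /= ->.
Qed.

(** By [subseq_map_nth], a block of [wact s w] is a subword of [w] exactly when [s] increases along
    it. Thus [Xi] enumerates the cuts of [w] into subwords. *)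
Lemma descents_reshape n q (s : 'S_n) w : 0%N \notin q -> sumn q = n ->
  uniq w -> size w = n ->
  all (fun i => i \in cuts q) (descents s) =
  all (fun b => subseq b w) (reshape q (wact s w)).
Proof.
move=> q0 sq uw sw; rewrite wactE reshape_map all_map.
set t := map (appn s) (iota 0 n).
have st : size t = n by rewrite size_map size_iota.
have nt i : (i < n)%N -> nth 0%N t i = appn s i.
  by move=> lin; rewrite (nth_map 0%N) ?size_iota // nth_iota.
have tw : all (gtn (size w)) t.
  by apply/allP => x /mapP[i]; rewrite mem_iota /= sw => lin ->; apply: appn_lt.
have -> : all (preim (map (nth 0%N w)) (fun b => subseq b w)) (reshape q t)
        = all (sorted ltn) (reshape q t).
  apply: eq_in_all => c ct /=; apply: subseq_map_nth => //.
  apply/allP => i ic; apply: (allP tw); rewrite -[t](@reshapeKr _ q) ?st ?sq //.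
  by apply/flattenP; exists c.
apply/idP/idP => [H|/(sorted_reshape q0)].
  apply/sorted_reshape; rewrite ?st // => i /andP[i0 lin] iq; rewrite !nt //; last by lia.
  move: iq; apply: contraR; rewrite -leqNgt leq_eqVlt => /orP[/eqP/appn_inj e|d].
    by have := e lin; lia.
  by apply: (allP H); rewrite mem_filter d mem_iota; lia.
rewrite st => /(_ sq) H; apply/allP => i; rewrite mem_filter mem_iota => /andP[d ir].
apply: contraLR d => iq; rewrite -leqNgt ltnW // -!nt; try lia.
by apply: H => //; lia.
Qed.

Lemma wact_inj n (w : seq nat) (s t : 'S_n) : uniq w -> size w = n ->
  wact s w = wact t w -> s = t.
Proof.
move=> uw sw e; apply/permP => i; apply: val_inj; rewrite /= -!appn_ord.
have := congr1 (fun u => nth 0%N u i) e; rewrite !nth_wact // => /eqP.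
by rewrite nth_uniq ?sw ?appn_lt // => /eqP.
Qed.

Lemma permutations_wact n (w : seq nat) : uniq w -> size w = n ->
  perm_eq (permutations w) [seq wact s w | s <- enum 'S_n].
Proof.
move=> uw sw; rewrite perm_sym.
have us : uniq [seq wact s w | s <- enum 'S_n].
  by rewrite map_inj_uniq ?enum_uniq // => s t; apply: wact_inj.
apply: uniq_perm => //; first exact: permutations_uniq.
apply: (uniq_min_size us _ _).2.
  by move=> x /mapP[s _ ->]; rewrite mem_permutations wact_perm.
by rewrite size_permutations // size_map -cardE card_Sn sw.
Qed.

(** * The group algebra inside the word algebra *)

Section Link.
Variable F : fieldType.
Implicit Types (w q : seq nat).
Local Notation wd := (wd F).
Local Notation lie := (lie F).
Local Notation lieconv := (lieconv F).

Lemma act_shifta n m (a : galg F m) (w1 w2 w3 : seq nat) :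
  size w2 = m -> (size w1 + m + size w3 = n)%N ->
  act (shifta n (size w1) a) (w1 ++ w2 ++ w3) = wd w1 * act a w2 * wd w3.
Proof.
move=> s2 sn; rewrite /shifta act_sum /act mulr_sumr mulr_suml.
apply: eq_bigr => s _; rewrite -/(act _ _) act_scale act_delta wact_shiftp //.
by rewrite -walg_scalerAr -scalerAl !wdM catA.
Qed.

(** The prefix [w1] of length [r] makes induction on [q] possible: the factors of the later blocks
    act first and treat the first block as part of the prefix. *)
Lemma act_omega_up_shift n r q w1 w2 :
  size w1 = r -> size w2 = sumn q -> (r + sumn q = n)%N ->
  act (foldr (@gmul F n) (gone F n)
    [seq shifta n (r + qplus q j) (omega F (nth 0%N q j)) | j <- iota 0 (size q)])
    (w1 ++ w2) = wd w1 * \prod_(b <- reshape q w2) lie b.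
Proof.
elim: q r w1 w2 => [|m q IH] r w1 w2 s1 s2 sn.
  move/size0nil: s2 => ->; rewrite big_nil mulr1 cats0 act_one //.
  by rewrite s1 -sn addn0.
move: s2 sn => /= s2 sn; rewrite big_cons act_gmul.
have -> : [seq shifta n (r + qplus (m :: q) j) (omega F (nth 0%N (m :: q) j)) | j <- iota 1 (size q)]
  = [seq shifta n (r + m + qplus q j) (omega F (nth 0%N q j)) | j <- iota 0 (size q)].
  rewrite (iotaDl 1 0) -map_comp; apply: eq_map => j /=.
  by rewrite /qplus /= addnA.
set b := take m w2; set d := drop m w2.
have sb : size b = m by rewrite size_takel // s2 leq_addr.
have sd : size d = sumn q by rewrite size_drop s2 addKn.
have -> : w1 ++ w2 = (w1 ++ b) ++ d by rewrite -catA cat_take_drop.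
rewrite (IH (r + m)%N) ?size_cat ?s1 ?sb -?addnA // extM ext_wd.
have H v : v \in msupp (\prod_(b <- reshape q d) lie b) ->
   act (shifta n (r + qplus (m :: q) 0) (omega F m)) ((w1 ++ b) ++ v) = wd w1 * lie b * wd v.
  move/msupp_prod_lie; rewrite -/(shape _) reshapeKl ?sd // => sv.
  rewrite /qplus take0 addn0 -s1 -catA -sb act_shifta ?act_omega //.
  by rewrite s1 sb sv -sn addnA.
by rewrite (eq_ext H) ext_mull ext_id mulrA.
Qed.

Lemma act_omega_up n q w : size w = n -> sumn q = n ->
  act (omega_up F n q) w = \prod_(b <- reshape q w) lie b.
Proof.
move=> sw sq; have := @act_omega_up_shift n 0 q [::] w erefl.
by rewrite sw sq add0n mul1r => <-.
Qed.

Lemma act_Xi n q w : 0%N \notin q -> sumn q = n -> uniq w -> size w = n ->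
  act (Xi F n q) w = \sum_(B <- blocks (fun b => subseq b w) q w) wd (flatten B).
Proof.
move=> q0 sq uw sw; rewrite act_sum.
under eq_bigr => s _ do rewrite act_delta.
rewrite /blocks big_filter big_map big_mkcond /=.
rewrite [RHS]big_mkcond (perm_big _ (permutations_wact uw sw)) big_map big_enum /=.
apply: eq_bigr => s _; rewrite -/(cuts q) (descents_reshape s q0 sq uw sw).
by rewrite reshapeKr ?size_wact ?sq.
Qed.

(** [Xi] acts first and lists the cuts of [w] into subwords; [omega_up] then brackets every
    block. *)
Lemma act_omega_q n q w : 0%N \notin q -> sumn q = n -> uniq w -> size w = n ->
  act (omega_q F n q) w = lieconv q w.
Proof.
move=> q0 sq uw sw; rewrite act_gmul act_Xi // linear_sum.
rewrite (@lieconv_blocks F q w w uw (subseq_refl w)) ?sq ?sw //.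
apply: eq_big_seq => B; rewrite mem_blocks ?sq ?sw // => /and3P[/eqP sB pB _] /=.
rewrite ext_wd act_omega_up ?(perm_size pB) //.
by rewrite -sB flattenK.
Qed.

(** The linear embedding that identifies permutations with their words; being injective, it allows
    identities in the group algebra to be checked on words. *)
Definition galg_words n (a : galg F n) : walg F := act a (iota 1 n).

Lemma wact_iota n (s : 'S_n) : wact s (iota 1 n) = word s.
Proof. by rewrite /wact /word; apply: eq_map => i; rewrite nth_iota. Qed.

Lemma galg_wordsE n (a : galg F n) : galg_words a = \sum_s a s *: wd (word s).
Proof. by apply: eq_bigr => s _; rewrite wact_iota. Qed.

Lemma word_inj n : injective (@word n).
Proof.
move=> s t; rewrite -!wact_iota; apply: wact_inj; rewrite ?iota_uniq //.
by rewrite size_iota.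
Qed.

Lemma galg_words_inj n : injective (@galg_words n).
Proof.
move=> a b e; apply/ffunP => s.
have coef (c : galg F n) : (galg_words c)@_(word s) = c s.
  rewrite galg_wordsE raddf_sum (bigD1 s) //= mcoeffZ coef_wd eqxx mulr1 big1 ?addr0 //.
  move=> t /negPf ts; rewrite mcoeffZ coef_wd (inj_eq (@word_inj n)) ts.
  by rewrite mulr0.
by rewrite -!coef e.
Qed.

Lemma word_perm n (s : 'S_n) : perm_eq (word s) (iota 1 n).
Proof. by rewrite -wact_iota wact_perm ?size_iota. Qed.

Lemma galg_words_omega_q n q (x : galg F n) : 0%N \notin q -> sumn q = n ->
  galg_words (gmul (omega_q F n q) x) = ext (lieconv q) (galg_words x).
Proof.
move=> q0 sq; rewrite {1}/galg_words act_gmul -/(galg_words x) galg_wordsE !linear_sum; apply: eq_bigr => s _ /=.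
have ws := word_perm s.
rewrite !linearZ /= !ext_wd act_omega_q //; first by rewrite (perm_uniq ws) iota_uniq.
by rewrite (perm_size ws) size_iota.
Qed.

Lemma galg_words_perm_of_word n w : perm_eq w (iota 1 n) -> galg_words (perm_of_word F n w) = wd w.
Proof.
move=> pw; rewrite /perm_of_word; case: pickP => [s /eqP <-|N].
  by rewrite /galg_words act_delta wact_iota.
have := permutations_wact (iota_uniq 1 n) (size_iota 1 n).
move/perm_mem/(_ w); rewrite mem_permutations pw => /esym/mapP[s _ e].
by have := N s; rewrite e wact_iota eqxx.
Qed.

Definition lc_eval (l : lincomb F) : walg F := \sum_(x <- l) x.1 *: wd x.2.

Lemma galg_words_to_alg n (l : lincomb F) :
  {in l, forall x, perm_eq x.2 (iota 1 n)} -> galg_words (to_alg n l) = lc_eval l.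
Proof.
move=> pl; rewrite /galg_words /to_alg act_sum /lc_eval.
by apply: eq_big_seq => x /pl px; rewrite act_scale -/(galg_words _) galg_words_perm_of_word.
Qed.

Lemma lc_evalM (a b : lincomb F) : lc_eval (lc_mul a b) = lc_eval a * lc_eval b.
Proof.
rewrite /lc_eval /lc_mul big_allpairs_dep mulr_suml; apply: eq_bigr => x _.
by rewrite mulr_sumr; apply: eq_bigr => y _; rewrite walg_scaleM wdM.
Qed.

Lemma lc_eval_Qw w : lc_eval (Qw F w) = lie w.
Proof. by rewrite /lc_eval big_map big_enum -act_omega. Qed.

Lemma lc_eval_QT T : lc_eval (QT F T) = \prod_(t <- T) lie t.
Proof.
elim: T => [|t T IH]; first by rewrite /lc_eval big_seq1 big_nil scale1r.
by rewrite [QT F _]/(lc_mul _ _) lc_evalM IH lc_eval_Qw big_cons.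
Qed.

Lemma QT_perm T x : x \in QT F T -> perm_eq x.2 (flatten T).
Proof.
elim: T x => [|t T IH] x; first by rewrite inE => /eqP ->.
case/allpairsP=> -[y z] /= [/mapP[s _ ->] /IH pz ->] /=.
by apply: perm_cat => //; apply: wact_perm.
Qed.

Lemma galg_words_QT n T : perm_eq (flatten T) (iota 1 n) ->
  galg_words (to_alg n (QT F T)) = \prod_(t <- T) lie t.
Proof.
(* Every word of [QT F T] rearranges [1, ..., n], so [perm_of_word] never takes its default value
   0. *)
move=> pT; rewrite galg_words_to_alg ?lc_eval_QT // => x /QT_perm px.
exact: perm_trans px pT.
Qed.

End Link.

(** * Blocks up to rearrangement *)

(** The order in which [inGamma] lists blocks: longer ones first, equal lengths by first letter. *)
Definition block_le (a b : seq nat) :=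
  (size b < size a)%N || (size a == size b) && (head 0%N a <= head 0%N b)%N.

Lemma block_le_total : total block_le.
Proof. by move=> a b; rewrite /block_le; lia. Qed.

Lemma block_le_trans : transitive block_le.
Proof. by move=> b a c; rewrite /block_le; lia. Qed.

Lemma uniq_flatten_mem (T : eqType) (s : seq (seq T)) a b x :
  uniq (flatten s) -> a \in s -> b \in s -> x \in a -> x \in b -> a = b.
Proof.
elim: s => //= c s IH; rewrite cat_uniq => /and3P[_ /hasPn nc us].
rewrite !inE => /orP[/eqP->|aS] /orP[/eqP->|bS] // xa xb; last exact: IH.
  have /nc : x \in flatten s by apply/flattenP; exists b.
  by rewrite /= xa.
have /nc : x \in flatten s by apply/flattenP; exists a.
by rewrite /= xb.
Qed.

Lemma uniq_flatten_block (T : eqType) (s : seq (seq T)) a :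
  uniq (flatten s) -> a \in s -> uniq a.
Proof.
elim: s => //= c s IH; rewrite cat_uniq => /and3P[uc _ us].
by rewrite inE => /orP[/eqP ->|/IH ->].
Qed.

Lemma uniq_of_flatten (T : eqType) (s : seq (seq T)) :
  uniq (flatten s) -> [::] \notin s -> uniq s.
Proof.
elim: s => //= c s IH; rewrite cat_uniq inE negb_or => /and3P[_ /hasPn nc us].
case/andP=> cn sn; rewrite IH // andbT; apply/negP => cs.
case: c cn nc cs => // x c _ nc cs.
have /nc : x \in flatten s by apply/flattenP; exists (x :: c); rewrite // mem_head.
by rewrite /= mem_head.
Qed.

Lemma head_mem (a : seq nat) : a != [::] -> head 0%N a \in a.
Proof. by case: a => // x a _; exact: mem_head. Qed.

(** With [f] the length, this arranges the blocks of a tuple so that their lengths follow [q]. *)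
Lemma perm_preimage (S T : eqType) (f : S -> T) (s : seq S) (t : seq T) :
  perm_eq (map f s) t -> exists2 s', perm_eq s' s & map f s' = t.
Proof.
case: s => [|x0 s0]; first by move/perm_size/esym/size0nil ->; exists [::].
set s := x0 :: s0; rewrite perm_sym => /(perm_iotaP (f x0))[r pr ->].
rewrite size_map in pr; exists (map (nth x0 s) r).
  have := perm_map (nth x0 s) pr; rewrite map_nth_iota0 // take_size.
  by [].
rewrite -map_comp; apply/eq_in_map => i ir; apply: esym; apply: nth_map.
by have := perm_mem pr i; rewrite ir mem_iota => /esym.
Qed.

Lemma perm_lam q : perm_eq (lam q) q.
Proof. by rewrite perm_sort. Qed.

Section Gamma.
Variables (n : nat) (q : seq nat).
Hypothesis (q0 : 0%N \notin q).
Implicit Types T : seq (seq nat).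

Lemma gamma_nonempty T : inGamma n (lam q) T -> [::] \notin T.
Proof.
case=> sT _ _ _; apply: contra q0 => nT.
by rewrite -(perm_mem (perm_lam q)) -sT; apply/mapP; exists [::].
Qed.

Lemma gamma_flatten_uniq T : inGamma n (lam q) T -> uniq (flatten T).
Proof. by case=> _ /perm_uniq -> _ _; exact: iota_uniq. Qed.

Lemma gamma_sorted T : inGamma n (lam q) T -> sorted block_le T.
Proof.
case=> sT _ _ hT; apply/(sortedP [::]) => i iT; rewrite /block_le.
have : (size (nth [::] T i.+1) <= size (nth [::] T i))%N.
  have : sorted geq (lam q) by apply: sort_sorted => a b; exact: leq_total.
  move/(sortedP 0%N)/(_ i); rewrite -sT size_map => /(_ iT).
  by rewrite !(nth_map [::]) // ltnW.
rewrite leq_eqVlt => /orP[/eqP e|->] //; rewrite e ltnn eqxx /=.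
by apply/ltnW/hT; rewrite ?e // ltnSn.
Qed.

(** Both tuples are sorted by [block_le], which is antisymmetric here: disjoint nonempty blocks with
    the same first letter coincide. *)
Lemma gamma_inj T T' : inGamma n (lam q) T -> inGamma n (lam q) T' ->
  perm_eq T T' -> T = T'.
Proof.
move=> gT gT'; apply: sorted_eq_in (gamma_sorted gT) (gamma_sorted gT').
  by move=> a b c _ _ _; exact: block_le_trans.
move=> a b aT bT; rewrite /block_le => ab.
apply: (uniq_flatten_mem (gamma_flatten_uniq gT) aT bT (x := head 0%N a)).
  by apply: head_mem; apply: contraTneq aT => ->; exact: gamma_nonempty.
have -> : head 0%N a = head 0%N b by lia.
by apply: head_mem; apply: contraTneq bT => ->; exact: gamma_nonempty.
Qed.

Lemma gamma_sort T : perm_eq (map size T) q -> perm_eq (flatten T) (iota 1 n) ->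
  all minfirst T -> inGamma n (lam q) (sort block_le T).
Proof.
move=> sT pT mT; set S := sort _ _.
have pS : perm_eq S T by rewrite perm_sort.
have oS : sorted block_le S by apply: sort_sorted; exact: block_le_total.
have nS : [::] \notin S.
  rewrite (perm_mem pS); apply: contra q0 => nT.
  by rewrite -(perm_mem sT); apply/mapP; exists [::].
have uS : uniq (flatten S).
  by rewrite (perm_uniq (perm_flatten pS)) (perm_uniq pT) iota_uniq.
split.
- apply: (@sorted_eq _ geq).
  + by move=> a b c; lia.
  + by move=> a b; lia.
  + apply: homo_sorted oS => a b; rewrite /block_le /=; lia.
  + by apply: sort_sorted => a b; exact: leq_total.
  + by rewrite (permPr (perm_lam q)) (permPl (perm_map size pS)).
- exact: perm_trans (perm_flatten pS) pT.
- by rewrite (perm_all _ pS).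
move=> k k' /andP[kk' k'S] e; have kS := ltn_trans kk' k'S.
have := sorted_ltn_nth block_le_trans [::] oS k k' kS k'S kk'.
rewrite /block_le e ltnn eqxx /= leq_eqVlt => /orP[/eqP h|] //.
(* Two blocks of equal length with the same first letter would coincide, so the comparison of first
   letters is strict. *)
have ek : nth [::] S k = nth [::] S k'.
  apply: (uniq_flatten_mem uS (x := head 0%N (nth [::] S k))); rewrite ?mem_nth //.
    by apply: head_mem; apply: contraNneq nS => <-; rewrite mem_nth.
  by rewrite h; apply: head_mem; apply: contraNneq nS => <-; rewrite mem_nth.
by move/eqP: ek; rewrite nth_uniq ?uniq_of_flatten // => /eqP ek; rewrite ek ltnn in kk'.
Qed.

Variable G : seq (seq (seq nat)).
Hypotheses (sq : sumn q = n) (uG : uniq G).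
Hypothesis GP : forall T, T \in G <-> inGamma n (lam q) T.

Lemma gamma_size T : T \in G -> size T = size q.
Proof. by case/GP=> sT _ _ _; rewrite -(perm_size (perm_lam q)) -sT size_map. Qed.

(** Sorting the blocks of a decomposition gives the unique member of Gamma in its rearrangement
    class. *)
Lemma blocks_gamma (w : seq nat) : perm_eq w (iota 1 n) ->
  perm_eq (blocks minfirst q w)
    [seq A | T <- G, A <- [seq A <- permutations T | map size A == q]].
Proof.
move=> pw; have sw : sumn q = size w by rewrite (perm_size pw) size_iota.
apply: uniq_perm; first exact: blocks_uniq.
  apply: allpairs_uniq_dep => // [T _|].
    by rewrite filter_uniq ?permutations_uniq.
  move=> x y /allpairsPdep[T [A [TG AT ->]]] /allpairsPdep[T' [A' [TG' AT' ->]]] /= e.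
  subst A'; move: AT AT'; rewrite !mem_filter !mem_permutations => /andP[_ p] /andP[_ p'].
  suff -> : T = T' by [].
  apply: gamma_inj; [exact/GP | exact/GP | rewrite perm_sym].
  by apply: perm_trans p; rewrite perm_sym.
move=> B; rewrite mem_blocks //; apply/and3P/allpairsPdep.
  case=> /eqP sB pB mB; have pS : perm_eq B (sort block_le B) by rewrite perm_sym perm_sort.
  exists (sort block_le B), B; split=> //.
    by apply/GP; apply: gamma_sort; rewrite ?sB // (permPl pB).
  by rewrite mem_filter sB eqxx mem_permutations.
case=> T [A [/GP[_ pT mT _] + ->]].
rewrite mem_filter mem_permutations => /andP[sA pA]; split=> //.
  by rewrite (permPl (perm_flatten pA)) (permPl pT) perm_sym.
by rewrite (perm_all _ pA).
Qed.

End Gamma.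

Definition mfact (q : seq nat) := (\prod_(i <- undup q) (count_mem i q)`!)%N.

Lemma mfact_sup (q r : seq nat) : uniq r -> {subset q <= r} ->
  mfact q = (\prod_(i <- r) (count_mem i q)`!)%N.
Proof.
move=> ur qr; rewrite [RHS](bigID (mem q)) /= [X in (_ * X)%N]big1 ?muln1.
  rewrite -[RHS]big_filter; apply: perm_big; apply: uniq_perm; rewrite ?undup_uniq ?filter_uniq //.
  by move=> i; rewrite mem_undup mem_filter; case: (boolP (i \in q)) => // /qr.
by move=> i /count_memPn ->.
Qed.

Lemma mfact_cons m q : mfact (m :: q) = (count_mem m (m :: q) * mfact q)%N.
Proof.
have ur := undup_uniq (m :: q); set r := undup (m :: q) in ur.
have mr : m \in r by rewrite mem_undup mem_head.
have qr : {subset q <= r} by move=> x xq; rewrite mem_undup inE xq orbT.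
rewrite (mfact_sup ur qr) /mfact -/r !(bigD1_seq m mr ur) /= eqxx factS mulnA.
congr (_ * _)%N; apply: eq_bigr => i im; rewrite eq_sym (negPf im) //.
Qed.

Lemma qmarkE q : qmark q = (\prod_(m <- q) m * mfact q)%N.
Proof.
rewrite /qmark big_split /= -/(mfact q); congr (_ * _)%N.
exact: big_undup_iterop_count.
Qed.

(** The first block is any of the blocks of length [m], as many as there are parts [m]; this is the
    recursion [mfact_cons]. *)
Lemma count_permutations_shape (U : seq (seq nat)) q : uniq U -> perm_eq (map size U) q ->
  count (fun A => map size A == q) (permutations U) = mfact q.
Proof.
elim: q U => [|m q IH] U uU pU.
  by case: U uU pU => [|u U] _ /perm_size //; rewrite /mfact big_nil.
have sU : (0 < size U)%N by rewrite -(size_map size) (perm_size pU).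
rewrite -sum1_count big_mkcond (perm_big _ (permutationsE sU)) /= big_allpairs_dep /=.
rewrite undup_id // mfact_cons -(seq.permP pU) count_map.
rewrite -sum1_count big_distrl /= [RHS]big_mkcond; apply: eq_big_seq => u uinU /=.
rewrite mul1n; case: eqP => um; last first.
  by rewrite big1 // => A _; rewrite eqseq_cons; case: eqP.
rewrite -(IH (rem u U)) ?rem_uniq //; last first.
  rewrite -(perm_cons m) -{1}um; apply: perm_trans pU; rewrite perm_sym.
  exact: perm_map (perm_to_rem uinU).
rewrite -sum1_count [RHS]big_mkcond; apply: eq_bigr => A _.
by rewrite eqseq_cons um eqxx.
Qed.

Lemma size_gamma n q G : 0%N \notin q -> sumn q = n -> uniq G ->
  (forall T, T \in G <-> inGamma n (lam q) T) -> size G = (n`! %/ qmark q)%N.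
Proof.
move=> q0 sq uG GP; have ui := iota_uniq 1 n; have si := size_iota 1 n.
have := size_blocks_minfirst ui q0 (etrans sq (esym si)).
rewrite (perm_size (blocks_gamma q0 sq uG GP (perm_refl _))) size_allpairs_dep si.
rewrite (_ : map _ G = [seq mfact q | _ <- G]); last first.
  apply/eq_in_map => T TG; have gT := (GP T).1 TG.
  rewrite size_filter; apply: count_permutations_shape.
    exact: uniq_of_flatten (gamma_flatten_uniq gT) (gamma_nonempty q0 gT).
  by case: gT => -> _ _ _; exact: perm_lam.
have -> : sumn [seq mfact q | _ <- G] = (size G * mfact q)%N.
  by elim: (G) => //= T G' ->; rewrite mulSn.
rewrite mulnCA -qmarkE => <-; rewrite mulnK // qmarkE muln_gt0.
apply/andP; split; last by apply: prodn_gt0 => i; exact: fact_gt0.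
rewrite big_seq prodn_cond_gt0 // => i iq; rewrite lt0n.
by apply: contraNneq q0 => <-.
Qed.

(** * Cycle type *)

Section CycleType.
Variable n : nat.
Implicit Types (s : 'S_n) (x y z : 'I_n) (T : seq (seq nat)).

Definition letter x : nat := (val x).+1.

Lemma letter_inj : injective letter.
Proof. by move=> x y [] /val_inj. Qed.

Lemma mem_orbit_porbit s x y : (y \in fingraph.orbit s x) = (y \in porbit s x).
Proof.
rewrite -fconnect_orbit; apply/idP/porbitP => [xy|[i ->]].
  by exists (findex s x y); rewrite permX iter_findex.
by rewrite permX fconnect_iter.
Qed.

Lemma size_orbit_porbit s x : size (fingraph.orbit s x) = #|porbit s x|.
Proof.
rewrite -(card_uniqP (orbit_uniq s x)); apply: eq_card => y.
by rewrite mem_orbit_porbit.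
Qed.

Definition orbit_min s x := all (fun y => val x <= val y)%N (fingraph.orbit s x).

(** One block per cycle, read from its minimum. The blocks are not sorted by length, so they are
    compared with Gamma up to order. *)
Definition cycle_words s : seq (seq nat) :=
  [seq map letter (fingraph.orbit s x) | x <- enum 'I_n & orbit_min s x].

Lemma orbit_min_inj s x y : orbit_min s x -> orbit_min s y ->
  porbit s x = porbit s y -> x = y.
Proof.
move=> mx my e; apply: val_inj; apply/eqP; rewrite eqn_leq.
rewrite (allP mx) ?mem_orbit_porbit ?e ?porbit_id //=.
by rewrite (allP my) ?mem_orbit_porbit -?e ?porbit_id.
Qed.

Lemma porbit_min s z : exists2 x, orbit_min s x & porbit s z = porbit s x.
Proof.
pose x := [arg min_(x < z | x \in porbit s z) val x].
have [xz xm] : x \in porbit s z /\ forall y, y \in porbit s z -> (x <= y)%N.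
  by rewrite /x; case: arg_minnP => [|i]; rewrite ?porbit_id.
have e : porbit s z = porbit s x by apply/eqP; rewrite eq_sym eq_porbit_mem.
by exists x => //; apply/allP => y; rewrite mem_orbit_porbit -e => /xm.
Qed.

Lemma lam_eqP q q' : reflect (lam q = lam q') (perm_eq q q').
Proof. by apply: perm_sortP => [a b|a b c|a b] /=; lia. Qed.

Lemma cycle_typeE s : cycle_type s = lam (map size (cycle_words s)).
Proof.
apply/lam_eqP.
rewrite -map_comp (eq_map (g := fun x => #|porbit s x|)); last first.
  by move=> x /=; rewrite size_map size_orbit_porbit.
rewrite (map_comp (fun X : {set 'I_n} => #|X|) (porbit s)); apply: perm_map.
apply: uniq_perm; first exact: enum_uniq.
  rewrite map_inj_in_uniq ?(filter_uniq _ (enum_uniq _)) // => x y.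
  by rewrite !mem_filter => /andP[mx _] /andP[my _]; exact: orbit_min_inj.
move=> X; rewrite mem_enum; apply/imsetP/mapP => [[z _ ->]|[x _ ->]]; last by exists x.
have [x mx ->] := porbit_min s z; exists x => //.
by rewrite mem_filter mx mem_enum.
Qed.

Lemma cycle_words_flatten s : perm_eq (flatten (cycle_words s)) (iota 1 n).
Proof.
have -> : iota 1 n = map letter (enum 'I_n).
  by rewrite (map_comp S val) val_enum_ord (iotaDl 1 0).
rewrite /cycle_words (map_comp (map letter) (fingraph.orbit s)) -map_flatten.
apply: perm_map; apply: uniq_perm; last 1 first.
- move=> z; rewrite mem_enum; apply/flatten_mapP; have [x mx e] := porbit_min s z.
  exists x; first by rewrite mem_filter mx mem_enum.
  by rewrite mem_orbit_porbit -e porbit_id.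
- set m := filter _ _; have -> : flatten (map (fingraph.orbit s) m)
      = [seq y | x <- m, y <- fingraph.orbit s x].
    by congr flatten; apply: eq_map => x; rewrite map_id.
  apply: allpairs_uniq_dep => [|x _|]; first exact: filter_uniq (enum_uniq _).
    exact: orbit_uniq.
  move=> a b /allpairsPdep[x [z [xm xz ->]]] /allpairsPdep[x' [z' [xm' xz' ->]]] /= ez.
  subst z'; suff -> : x = x' by [].
  move: xm xm' xz xz'; rewrite !mem_filter !mem_orbit_porbit -!eq_porbit_mem.
  move=> /andP[mx _] /andP[mx' _] /eqP e /eqP e'.
  by apply: (orbit_min_inj mx mx'); rewrite -e -e'.
- exact: enum_uniq.
Qed.

Lemma cycle_words_minfirst s : all minfirst (cycle_words s).
Proof.
apply/allP => t /mapP[x]; rewrite mem_filter => /andP[mx _] ->.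
have e : fingraph.orbit s x = x :: behead (fingraph.orbit s x).
  by rewrite /fingraph.orbit -orderSpred.
apply/allP => a /mapP[y yo ->]; rewrite {1}e /= ltnS.
exact: (allP mx).
Qed.

Lemma cycle_words_nonempty s : [::] \notin cycle_words s.
Proof.
apply/negP => /mapP[x _] /(congr1 size); rewrite size_map size_orbit.
by have := fingraph.order_gt0 s x; case: (fingraph.order s x).
Qed.

(** The inverse reading: each letter goes to the cyclically next one in its block. *)
Definition succ_in T (a : nat) := next (nth [::] T (find (fun t => a \in t) T)) a.

Lemma succ_inE T t a : uniq (flatten T) -> t \in T -> a \in t -> succ_in T a = next t a.
Proof.
move=> uT tT at_; have hT : has (fun t => a \in t) T by apply/hasP; exists t.
rewrite /succ_in; congr next.
apply: (uniq_flatten_mem uT (x := a)) => //; first by rewrite mem_nth -?has_find.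
exact: (nth_find [::] hT).
Qed.

Lemma succ_cycle_words s T x : perm_eq T (cycle_words s) ->
  succ_in T (letter x) = letter (s x).
Proof.
move=> pT; have [z mz e] := porbit_min s x.
have xz : x \in fingraph.orbit s z by rewrite mem_orbit_porbit -e porbit_id.
rewrite (@succ_inE T (map letter (fingraph.orbit s z))).
- rewrite (next_map letter_inj) ?orbit_uniq //; congr letter.
  by apply: nextE => //; apply: cycle_orbit; exact: perm_inj.
- by rewrite (perm_uniq (perm_flatten pT)) (perm_uniq (cycle_words_flatten s)) iota_uniq.
- by rewrite (perm_mem pT); apply/mapP; exists z; rewrite // mem_filter mz mem_enum.
by rewrite mem_map //; exact: letter_inj.
Qed.

Lemma letters_preim (t : seq nat) : all (fun a => 0 < a <= n)%N t ->
  exists t0 : seq 'I_n, t = map letter t0.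
Proof.
elim: t => [|a t IH] /=; first by exists [::].
case/andP=> /andP[a0 an] /IH[t0 ->].
have lan : (a.-1 < n)%N by rewrite prednK.
by exists (Ordinal lan :: t0); rewrite /= /letter /= prednK.
Qed.

(** The map to the cyclically next letter is injective, since the blocks are disjoint and [prev]
    inverts it within a block; its cycles are the blocks of [T]. *)
Lemma cycle_words_surj T : perm_eq (flatten T) (iota 1 n) -> all minfirst T ->
  [::] \notin T -> exists s, perm_eq T (cycle_words s).
Proof.
move=> pT mT nT; have uT : uniq (flatten T) by rewrite (perm_uniq pT) iota_uniq.
have pre t : t \in T -> exists t0 : seq 'I_n, t = map letter t0.
  move=> tT; apply: letters_preim; apply/allP => a at_.
  have : a \in iota 1 n by rewrite -(perm_mem pT); apply/flattenP; exists t.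
  by rewrite mem_iota; lia.
have in_block x : exists2 t, t \in T & letter x \in t.
  apply/flattenP; rewrite (perm_mem pT) mem_iota /= add1n ltnS.
  exact: ltn_ord.
have succ_lt x : ((succ_in T (letter x)).-1 < n)%N.
  have [t tT xt] := in_block x; rewrite (succ_inE uT tT xt).
  have : next t (letter x) \in iota 1 n.
    by rewrite -(perm_mem pT); apply/flattenP; exists t; rewrite ?mem_next.
  by rewrite mem_iota; lia.
pose f x := Ordinal (succ_lt x).
have ut0 (t0 : seq 'I_n) : map letter t0 \in T -> uniq t0.
  by move/(uniq_flatten_block uT); rewrite map_inj_uniq //; exact: letter_inj.
have blk x : exists2 t0, map letter t0 \in T & x \in t0.
  have [t tT xt] := in_block x; have [t0 e] := pre _ tT; exists t0; rewrite -?e //.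
  by move: xt; rewrite e mem_map //; exact: letter_inj.
have fE t0 x : map letter t0 \in T -> x \in t0 -> f x = next t0 x.
  move=> tT xt; apply: letter_inj.
  have e : succ_in T (letter x) = letter (next t0 x).
    by rewrite (succ_inE uT tT) ?map_f // (next_map letter_inj) // ut0.
  by rewrite /letter /= e.
have injf : injective f.
  move=> x y; have [t xT xt] := blk x; have [t' yT yt] := blk y.
  rewrite (fE t) // (fE t' y) // => e.
  have tt' : map letter t = map letter t'.
    apply: (uniq_flatten_mem uT xT yT (x := letter (next t x))).
      by rewrite map_f ?mem_next.
    by rewrite e map_f ?mem_next.
  have {}tt' := inj_map letter_inj tt'; subst t'.
  exact: (can_inj (prev_next (ut0 _ xT))) e.
exists (perm injf).
have sub : {subset T <= cycle_words (perm injf)}.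
  move=> t tT; have [t0 e] := pre _ tT.
  case: t0 e => [e|x t0 e]; first by rewrite e in tT; rewrite tT in nT.
  rewrite e in tT *; have u0 := ut0 _ tT.
  have cyc0 : fcycle (perm injf) (x :: t0).
    apply: cycle_from_next => // y yt; rewrite /= permE.
    by rewrite (fE _ _ tT yt).
  have o0 : fingraph.orbit (perm injf) x = x :: t0.
    by rewrite (fingraph.orbitE cyc0 u0) ?mem_head //= eqxx rot0.
  apply/mapP; exists x; last by rewrite o0.
  rewrite mem_filter mem_enum andbT /orbit_min o0; apply/allP => y yt.
  by have := allP (allP mT _ tT) _ (map_f letter yt).
have uC : uniq (flatten (cycle_words (perm injf))).
  by rewrite (perm_uniq (cycle_words_flatten _)) iota_uniq.
apply: uniq_perm; [exact: uniq_of_flatten | exact: uniq_of_flatten (cycle_words_nonempty _) |].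
(* A cycle shares a letter with some block of [T]; that block is itself a cycle, and cycles are
   disjoint. *)
move=> b; apply/idP/idP => [/sub //|bC].
have /mapP[x _ eb] := bC; have [t tT xt] := in_block x.
have xb : letter x \in b by rewrite eb map_f ?in_orbit.
by rewrite (uniq_flatten_mem uC bC (sub _ tT) xb xt).
Qed.

Lemma card_cycle_type q (G : seq (seq (seq nat))) : 0%N \notin q -> uniq G ->
  (forall T, T \in G <-> inGamma n (lam q) T) ->
  size G = #|[set s : 'S_n | cycle_type s == lam q]|.
Proof.
move=> q0 uG GP; pose W s := sort block_le (cycle_words s).
have pW s : perm_eq (W s) (cycle_words s) by rewrite perm_sort.
have ctP s : (cycle_type s == lam q) = perm_eq (map size (cycle_words s)) q.
  rewrite cycle_typeE; exact/eqP/lam_eqP.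
rewrite cardE -(size_map W); apply: perm_size; apply: uniq_perm => //.
  rewrite map_inj_uniq ?enum_uniq // => s s' e; apply/permP => x; apply: letter_inj.
  by rewrite -(succ_cycle_words x (pW s)) e (succ_cycle_words x (pW s')).
move=> T; apply/idP/mapP => [/GP gT|[s]].
  have [sT pT mT _] := gT.
  have [s ps] := cycle_words_surj pT mT (gamma_nonempty q0 gT).
  have sq : perm_eq (map size (cycle_words s)) q.
    by rewrite -(permPl (perm_map size ps)) sT perm_lam.
  exists s; first by rewrite mem_enum inE ctP.
  apply: gamma_inj gT _ _; rewrite ?(permPl ps) 1?perm_sym //.
  by apply: gamma_sort => //; rewrite ?cycle_words_flatten ?cycle_words_minfirst.
rewrite mem_enum inE ctP => sq ->; apply/GP.
by apply: gamma_sort; rewrite ?cycle_words_flatten ?cycle_words_minfirst.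
Qed.

End CycleType.

(** * The basis *)

Section Basis.
Variables (F : fieldType) (n : nat) (q : seq nat) (G : seq (seq (seq nat))).
Hypotheses (q0 : 0%N \notin q) (sq : sumn q = n) (uG : uniq G).
Hypothesis GP : forall T, T \in G <-> inGamma n (lam q) T.
Hypothesis q1 : (\prod_(m <- q) m)%:R != 0 :> F.
Implicit Types T A U : seq (seq nat).

Let v T := gmul (omega_q F n q) (to_alg n (QT F T)).

(** The image of the basis vector of [T], up to the scalar [q_1 ... q_k] ([galg_words_basis]). *)
Definition symprod T : walg F :=
  \sum_(A <- permutations T | map size A == q) \prod_(u <- A) lie F u.

Lemma galg_words_basis T : T \in G -> galg_words (v T) = (\prod_(m <- q) m)%:R *: symprod T.
Proof.
move=> TG; have gT := (GP T).1 TG; have [_ pT _ _] := gT.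
rewrite galg_words_omega_q // galg_words_QT // lieconv_prod ?(gamma_size GP TG) //.
  exact: gamma_nonempty gT.
exact: uniq_of_flatten (gamma_flatten_uniq gT) (gamma_nonempty q0 gT).
Qed.

Lemma galg_words_comb (c : 'I_(size G) -> F) :
  galg_words (\sum_(i < size G) gscale (c i) (v (nth [::] G i))) =
  \sum_(i < size G) (c i * (\prod_(m <- q) m)%:R) *: symprod (nth [::] G i).
Proof.
rewrite /galg_words act_sum; apply: eq_bigr => i _.
by rewrite act_scale -/(galg_words _) galg_words_basis ?mem_nth // scalerA.
Qed.

(** The coefficient at the word [flatten U] serves as the dual functional of [T0]: by
    [coef_prod_lie] it sees only the arrangement [U], which occurs in the class of [T0] alone. *)
Lemma coef_symprod T0 U T : T0 \in G -> perm_eq U T0 -> map size U = q -> T \in G ->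
  (symprod T)@_(flatten U) = (T == T0)%:R.
Proof.
move=> T0G pU sU TG; have gT := (GP T).1 TG; have gT0 := (GP T0).1 T0G.
have [_ _ mT _] := gT; have [_ _ mT0 _] := gT0.
have uniqs T' : inGamma n (lam q) T' -> all uniq T'.
  by move=> g; apply/allP => a; apply: uniq_flatten_block; exact: gamma_flatten_uniq g.
rewrite /symprod raddf_sum /= -big_filter.
rewrite (eq_big_seq (fun A => (A == U)%:R)) => [|A]; last first.
  rewrite mem_filter mem_permutations => /andP[/eqP sA pA].
  rewrite coef_prod_lie ?sA ?sU ?(perm_all _ pA) ?(perm_all _ pU) ?uniqs //.
  by rewrite (perm_mem pU); exact: gamma_nonempty gT0.
have [e|TT0] := eqVneq T T0.
  rewrite (bigD1_seq U) /= ?filter_uniq ?permutations_uniq //.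
    by rewrite eqxx big1 ?addr0 // => A /negPf ->.
  by rewrite mem_filter sU eqxx mem_permutations e.
rewrite big1_seq // => A /=; rewrite mem_filter mem_permutations => /andP[_ pA].
case: eqP => // e; move/eqP: TT0; case; apply: (gamma_inj q0 gT gT0).
by rewrite -(permPr pU) -e perm_sym.
Qed.

Lemma basis_free (c : 'I_(size G) -> F) :
  \sum_(i < size G) gscale (c i) (v (nth [::] G i)) = 0 -> forall i, c i = 0.
Proof.
move=> c0 i; have iG : nth [::] G i \in G by rewrite mem_nth.
have [sT _ _ _] := (GP _).1 iG.
(* The lengths of the blocks are [lam q], a rearrangement of [q], so some order of the blocks has
   length sequence [q]. *)
have [U pU sU] : exists2 U, perm_eq U (nth [::] G i) & map size U = q.
  by apply: perm_preimage; rewrite sT perm_lam.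
have := congr1 (fun a => (galg_words a)@_(flatten U)) c0.
rewrite galg_words_comb /galg_words act0 mcoeff0 raddf_sum /= (bigD1 i) //= [X in _ + X]big1 => [|j ji].
  rewrite addr0 mcoeffZ (coef_symprod iG pU sU iG) eqxx mulr1 => /eqP.
  by rewrite mulf_eq0 (negPf q1) orbF => /eqP.
rewrite mcoeffZ (coef_symprod iG pU sU) ?mem_nth // nth_uniq //.
by rewrite (inj_eq val_inj) (negPf ji) mulr0.
Qed.

(** The coefficient of a decomposition is a product over its blocks, hence constant on each
    rearrangement class. *)
Lemma lieconv_word w : perm_eq w (iota 1 n) ->
  lieconv F q w = \sum_(T <- G) (\prod_(t <- T) mincoef F w t) *: symprod T.
Proof.
move=> pw; rewrite lieconv_minfirst ?(perm_uniq pw) ?iota_uniq //; last first.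
  by rewrite (perm_size pw) size_iota.
rewrite (perm_big _ (blocks_gamma q0 sq uG GP pw)) /= big_allpairs_dep /=.
apply: eq_bigr => T _; rewrite big_filter /symprod scaler_sumr.
rewrite -big_filter -[RHS]big_filter; apply: eq_big_seq => A.
rewrite mem_filter mem_permutations => /andP[_ pA].
by rewrite (perm_big _ pA).
Qed.

Lemma basis_span (y : galg F n) : inLie q y ->
  exists c : 'I_(size G) -> F,
    y = \sum_(i < size G) gscale (c i) (v (nth [::] G i)).
Proof.
case=> x ->; pose m := (\prod_(m <- q) m)%:R : F.
(* The coefficients of [lieconv_word] summed over the words of [x]; the division undoes the scalar
   in [galg_words_basis]. *)
exists (fun i => (\sum_s x s * \prod_(t <- nth [::] G i) mincoef F (word s) t) / m).
apply: galg_words_inj; rewrite galg_words_comb galg_words_omega_q // galg_wordsE linear_sum /=.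
transitivity (\sum_(T <- G) \sum_s (x s * \prod_(t <- T) mincoef F (word s) t) *: symprod T).
  rewrite [RHS]exchange_big /=; apply: eq_bigr => s _.
  rewrite linearZ /= ext_wd lieconv_word ?word_perm // scaler_sumr.
  by apply: eq_bigr => T _; rewrite scalerA.
rewrite (big_nth [::]) big_mkord; apply: eq_bigr => i _.
by rewrite -scaler_suml mulfVK.
Qed.

End Basis.

Theorem mainTheorem4 (F : fieldType) (n : nat) (q : seq nat)
    (G : seq (seq (seq nat))) :
  is_composition n q -> coprime_char F q ->
  uniq G -> (forall T, T \in G <-> inGamma n (lam q) T) ->
  let v := fun T => gmul (omega_q F n q) (@to_alg F n (QT F T)) in
  [/\ (forall T, T \in G -> @inLie F n q (v T)),
      (forall c : 'I_(size G) -> F,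
         \sum_(i < size G) gscale (c i) (v (nth [::] G i)) = 0 ->
         forall i, c i = 0),
      (forall y : galg F n, @inLie F n q y ->
         exists c : 'I_(size G) -> F,
           y = \sum_(i < size G) gscale (c i) (v (nth [::] G i))),
      size G = (n`! %/ qmark q)%N &
      size G = #|[set s : 'S_n | cycle_type s == lam q]| ].
Proof.
case/andP=> /allP qpos /eqP sq cop uG GP v.
have q0 : 0%N \notin q by apply/negP => /qpos.
(* A part that vanishes in [F] would be divisible by the characteristic. *)
have q1 : (\prod_(m <- q) m)%:R != 0 :> F.
  rewrite natr_prod prodf_seq_neq0; apply/allP => m mq /=; apply/negP => m0.
  have [p pF] := natf0_pchar (qpos _ mq) m0.
  by have /negP := allP (cop p pF) m mq; rewrite (dvdn_pcharf pF).
split.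
- by move=> T _; exists (to_alg n (QT F T)).
- exact: basis_free.
- exact: basis_span.
- exact: size_gamma.
- exact: card_cycle_type.
Qed.
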